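(* Let $\Omega\subset\mathbb{C}$ be a bounded domain and $\varphi$ a smooth real-valued function on $\Omega$. Suppose that for every point $a\in\Omega$ there exist $\gamma_a\in(0,\delta(a))$ and a lower semi-continuous function $g_a\colon[0,\gamma_a]\to\mathbb{R}_{\geq0}$ such that $L_\varphi(a,r)\leq e^{-g_a(r)r^2}$ for all $r\in(0,\gamma_a)$. Then for every $a\in\Omega$, $$\sqrt{-1}\partial\overline{\partial}\varphi(a)\geq 2g_a(0)\,\omega,\qquad\text{i.e.}\qquad \frac{\partial^2\varphi}{\partial z\partial\bar z}(a)\geq 2g_a(0),$$ where $\omega=\sqrt{-1}\,\mathrm{d}z\wedge\mathrm{d}\bar z$.
   Context: For $a\in\mathbb{C}$ and $r>0$, $\Delta(a;r)=\{z\in\mathbb{C}\mid |z-a|<r\}$. For a domain $\Omega\subset\mathbb{C}$ and $a\in\Omega$, $\delta(a):=\sup\{r>0\mid \Delta(a;r)\subset\Omega\}$, and $\Omega_\delta:=\{(a,r)\in\Omega\times\mathbb{R}\mid 0<r<\delta(a)\}$. For a domain $D$ and a smooth real function $\varphi$, $A^2(D,\varphi)$ denotes the space of holomorphic functions $f$ on $D$ with $\int_D|f|^2e^{-\varphi}<\infty$ (integrals with respect to Lebesgue measure). The $L^2$-extension index of $\varphi$ is the function on $\Omega_\delta$ $$L_\varphi(a,r)=\frac{1}{\pi r^2K_{\Delta(a;r),\varphi}(a)}=\inf\left\{\frac{\int_{\Delta(a;r)}|f|^2e^{-\varphi}}{\pi r^2e^{-\varphi(a)}}\ \middle|\ f\in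 A^2(\Delta(a;r),\varphi),\ f(a)=1\right\},$$ where $K_{\Delta(a;r),\varphi}$ is the weighted Bergman kernel of $\Delta(a;r)$ with weight $e^{-\varphi}$. *)

(* Defs.v *)
From HB Require Import structures.
From mathcomp Require Import all_boot all_order all_algebra.
From mathcomp Require Import complex.
From mathcomp Require Import all_classical all_reals all_analysis.
Set Implicit Arguments. Unset Strict Implicit. Unset Printing Implicit Defensive.
Import Order.TTheory GRing.Theory Num.Theory.
Import numFieldNormedType.Exports.
Local Open Scope classical_set_scope.
Local Open Scope ring_scope.
Local Open Scope complex_scope.

(* C = R[i] with the topology/normed structure induced by its modulus
   (the standard structure of a numFieldType, as a normed space over itself) *)
HB.instance Definition _ (R : rcfType) := GRing.ComAlgebra.copy R[i] (R[i])^o.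
HB.instance Definition _ (R : rcfType) := Vector.copy R[i] (R[i])^o.
HB.instance Definition _ (R : rcfType) := NormedModule.copy R[i] (R[i])^o.

Section Defs.
Variable R : realType.

Definition toC (p : R * R) : R[i] := p.1 +i* p.2.

Definition leb2 := ((@lebesgue_measure R) \x (@lebesgue_measure R))%E.

Definition domain (O : set R[i]) : Prop :=
  O !=set0 /\ open O /\ connected O.

Definition disc (a : R[i]) (r : R) : set R[i] :=
  [set z | Num.sqrt ((complex.Re (z - a)) ^+ 2 + (complex.Im (z - a)) ^+ 2) < r].

Definition delta (O : set R[i]) (a : R[i]) : R :=
  sup [set r : R | 0 < r /\ disc a r `<=` O].

Definition holomorphic_on (D : set R[i]) (f : R[i] -> R[i]) : Prop :=
  forall z, D z -> derivable f z 1.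

Definition wnorm2 (phi : R[i] -> R) (D : set R[i]) (f : R[i] -> R[i]) : \bar R :=
  (\int[leb2]_(p in [set p | D (toC p)])
     (((complex.Re (f (toC p))) ^+ 2 + (complex.Im (f (toC p))) ^+ 2) * expR (- phi (toC p)))%:E)%E.

Definition A2 (D : set R[i]) (phi : R[i] -> R) (f : R[i] -> R[i]) : Prop :=
  holomorphic_on D f /\ (wnorm2 phi D f < +oo)%E.

Definition L2index (phi : R[i] -> R) (a : R[i]) (r : R) : R :=
  inf [set q : R | exists f : R[i] -> R[i],
         [/\ A2 (disc a r) phi f, f a = 1 &
             q = fine (wnorm2 phi (disc a r) f) / (pi * r ^+ 2 * expR (- phi a))]].

Definition dx (F : R -> R -> R) : R -> R -> R := fun x y => derive1 (fun t => F t y) x.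
Definition dy (F : R -> R -> R) : R -> R -> R := fun x y => derive1 (fun t => F x t) y.

Fixpoint Ck (k : nat) (F : R -> R -> R) (U : set (R * R)) : Prop :=
  match k with
  | 0 => forall p, U p -> {for p, continuous (fun q : R * R => F q.1 q.2)}
  | k'.+1 =>
      (forall p, U p -> derivable (fun t => F t p.2) p.1 1 /\
                        derivable (fun t => F p.1 t) p.2 1)
      /\ (forall p, U p -> {for p, continuous (fun q : R * R => F q.1 q.2)})
      /\ Ck k' (dx F) U /\ Ck k' (dy F) U
  end.

Definition phi2 (phi : R[i] -> R) : R -> R -> R := fun x y => phi (x +i* y).

Definition smooth_on (O : set R[i]) (phi : R[i] -> R) : Prop :=
  forall k, Ck k (phi2 phi) [set p | O (toC p)].

(* d^2 phi / dz dzbar = (1/4) (phi_xx + phi_yy) *)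
Definition ddbar (phi : R[i] -> R) (a : R[i]) : R :=
  4^-1 * (dx (dx (phi2 phi)) (complex.Re a) (complex.Im a) + dy (dy (phi2 phi)) (complex.Re a) (complex.Im a)).

Definition lsc_on (A : set R) (g : R -> R) : Prop :=
  forall x, A x -> forall e : R, 0 < e ->
    \forall y \near x, A y -> g x - e < g y.

End Defs.

(* Main.v *)
Require Import Defs.
From HB Require Import structures.
From mathcomp Require Import all_boot all_order all_algebra.
From mathcomp Require Import complex.
From mathcomp Require Import all_classical all_reals all_analysis.
From mathcomp Require Import measurable_realfun ring lra.
Import Order.TTheory GRing.Theory Num.Theory.
Import numFieldNormedType.Exports.
Local Open Scope classical_set_scope.
Local Open Scope ring_scope.
Set Implicit Arguments.
Unset Strict Implicit.
Unset Printing Implicit Defensive.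

(** Write [phi = phi(a) + Re h + lam |z - a|^2 + o(|z - a|^2)] with
    [h = c (z - a) + b (z - a)^2] holomorphic and
    [lam = d^2 phi / dz dzbar (a)], and put [p = 1 - h/2 + h^2/8], so that
    [|p|^2 e^(phi - phi(a)) <= 1 + m |z - a|^2] near [a] for every [m > lam].
    For holomorphic [f] with [f a = 1], completing the square gives
    [|f|^2 e^(phi(a) - phi) >= 2 Re (f p) - |p|^2 e^(phi - phi(a))], and
    [Re (f p)] has mean value [1] on circles centred at [a].  Integrating in
    polar coordinates, [L_phi(a, r) >= 1 - m r^2 / 2] for small [r].  Comparing
    with [L_phi(a, r) <= e^(- g_a(r) r^2)] as [r -> 0] yields
    [lam >= 2 g_a(0)].

    Holomorphy is mere complex differentiability at every point, so the mean
    value property is obtained by Goursat's bisection, applied in polar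
    coordinates [(rho, theta)] to the closed form [v drho / rho + u dtheta],
    where [u + i v = F(z) + F(- z)].  Being even, this function needs only the
    half circle [|theta| <= pi / 2], on which the two radial sides cancel. *)

(** * Goursat's lemma for closed 1-forms *)

(** A lower bound for the index has to hold for every competitor [f] at once. Completing the square
    provides it: what remains is linear in [f], and the mean value property evaluates it from the
    value at the centre alone. The polynomial [p] stands in for [exp(- h/2)], so that only sums and
    products of Cauchy-Riemann pairs occur. Its quadratic term cannot be dropped:
    [|1 - h/2|^2 = 1 - Re h + |h|^2/4] differs from [exp(- Re h)] at second order, the order of
    [lam] itself, whereas with [h^2/8] the discrepancy is cubic in [h]. The closed form is the
    imaginary part of [(u + i v) dz / z], because [dz / z = drho / rho + i dtheta]. Its pole
    confines the rectangles to [rho > 0], and the centre is reached by shrinking the inner radius.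
    The half circle also suits the integration: on [|theta| < pi / 2] the slope [tan theta] is a
    coordinate, so almost all of the plane is swept by lines of slope [u] with a signed radius, and
    the two signs of the radius supply the points [z] and [- z]. *)

Section Goursat.
Variable R : realType.
Notation mu := (@lebesgue_measure R).
Implicit Types (a b c d e : R).

Definition fint (f : R -> R) a b : R := \int[mu]_(x in `[a, b]) f x.

(** Continuity is two-sided also at the end points, which is stronger than continuity within the
    segment and passes to subsegments at once. *)
Definition cont_on (f : R -> R) a b :=
  forall x, a <= x <= b -> {for x, continuous f}.

Lemma near_dist_le (x d : R) : 0 < d -> \forall y \near x, `|y - x| <= d.
Proof.
by move=> d0; apply/nbhs_ballP; exists d => //= y; rewrite /ball/= distrC => /ltW.
Qed.

Lemma cont_on_within f a b : cont_on f a b -> {within `[a, b], continuous f}.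
Proof.
move=> cf; apply: continuous_in_subspaceT => x; rewrite inE/= in_itv/= => xab.
exact: cf.
Qed.

Lemma cont_on_integrable f a b :
  cont_on f a b -> mu.-integrable `[a, b] (EFin \o f).
Proof.
move=> cf; apply: continuous_compact_integrable; first exact: segment_compact.
exact: cont_on_within.
Qed.

Lemma fint_split f a b c : a <= c -> c <= b -> cont_on f a b ->
  fint f a b = fint f a c + fint f c b.
Proof.
move=> ac cb cf; rewrite /fint.
have := @Rintegral_itvB R f (BLeft a) (BRight b) c (cont_on_integrable cf).
rewrite !bnd_simp => /(_ ac cb)/eqP; rewrite subr_eq addrC => /eqP ->.
congr (_ + _); rewrite Rintegral_itv_obnd_cbnd//.
apply: integrableS (cont_on_integrable cf) => //.
by apply: subset_itv; rewrite bnd_simp.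
Qed.

Lemma fint_cst k a b : a <= b -> fint (fun=> k) a b = k * (b - a).
Proof.
move=> ab; rewrite /fint Rintegral_cst//= lebesgue_measure_itv/= lte_fin.
by move: ab; rewrite le_eqVlt => /predU1P[->|->] //; rewrite ltxx subrr !mulr0.
Qed.

Lemma fint_near f k m a b : a <= b -> cont_on f a b ->
  (forall x, a <= x <= b -> `|f x - k| <= m) ->
  `|fint f a b - k * (b - a)| <= m * (b - a).
Proof.
move=> ab cf fk; rewrite -fint_cst// /fint -RintegralB//; last 2 first.
- exact: cont_on_integrable.
- by apply: cont_on_integrable => x _; exact: cst_continuous.
have cfk : cont_on (fun x => f x - k) a b.
  by move=> x xab; apply: continuousB; [exact: cf|exact: cst_continuous].
apply: le_trans (le_normr_Rintegral _ (cont_on_integrable cfk)) _ => //.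
rewrite -fint_cst//; apply: le_Rintegral => //.
- apply: (@cont_on_integrable (fun x => `|f x - k|)) => x xab.
  by apply: continuous_comp; [exact: cfk|exact: norm_continuous].
- by apply: cont_on_integrable => x _; exact: cst_continuous.
Qed.

(** Fréchet differentiability at [(s, t)] with partial derivatives [A] and [B], unfolded with the l1
    norm. Nothing is asked of the partials at other points, which is all that pointwise complex
    differentiability can provide. *)
Definition cdiff (Q : R -> R -> R) s t A B :=
  forall e, 0 < e -> exists2 d, 0 < d &
    forall s' t', `|s' - s| <= d -> `|t' - t| <= d ->
      `|Q s' t' - Q s t - A * (s' - s) - B * (t' - t)| <=
        e * (`|s' - s| + `|t' - t|).

Lemma cdiff_continuous1 Q s t A B : cdiff Q s t A B ->
  {for s, continuous (Q ^~ t)}.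
Proof.
move=> /(_ 1 ltr01)[d d0 H]; apply/cvgrPdist_le => e e0.
near=> s'.
have := H s' t; rewrite subrr normr0 mulr0 subr0 addr0 mul1r => /(_ _ (ltW d0)).
have s'd : `|s' - s| <= d.
  by near: s'; exact: near_dist_le.
have s'e : `|s' - s| <= e / (1 + `|A|).
  near: s'; apply: near_dist_le.
  by rewrite divr_gt0// ltr_pwDl.
move=> /(_ s'd) H1; rewrite distrC.
have -> : Q s' t - Q s t = (Q s' t - Q s t - A * (s' - s)) + A * (s' - s) by ring.
apply: le_trans (ler_normD _ _) _; rewrite normrM.
have : `|s' - s| * (1 + `|A|) <= e.
  by rewrite -ler_pdivlMr// ltr_pwDl.
lra.
Unshelve. all: by end_near. Qed.

Lemma cdiff_swap Q s t A B : cdiff Q s t A B -> cdiff (fun t s => Q s t) t s B A.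
Proof.
move=> H e /H[d d0 {}H]; exists d => // t' s' td sd.
by rewrite (addrC `|t' - t|) addrAC H.
Qed.

Lemma cdiff_continuous2 Q s t A B : cdiff Q s t A B ->
  {for t, continuous (Q s)}.
Proof. by move=> /cdiff_swap/cdiff_continuous1. Qed.

Section rectangle.
Variables (P Q : R -> R -> R).

(* Circulation of the 1-form P ds + Q dt around the rectangle [a, b] x [c, d]. *)
Definition circ a b c d : R :=
  (fint (Q b) c d - fint (Q a) c d) - (fint (P ^~ d) a b - fint (P ^~ c) a b).

(** The shared [B] expresses [dP/dt = dQ/ds] at this single point. *)
Definition closed_at s t := exists A B C, cdiff P s t A B /\ cdiff Q s t B C.

Lemma closed_at_cont s t : closed_at s t ->
  [/\ {for s, continuous (P ^~ t)}, {for t, continuous (P s)},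
      {for s, continuous (Q ^~ t)} & {for t, continuous (Q s)}].
Proof.
move=> [A [B [C [p q]]]]; split.
- exact: cdiff_continuous1 p.
- exact: cdiff_continuous2 p.
- exact: cdiff_continuous1 q.
- exact: cdiff_continuous2 q.
Qed.

Definition closed_rect a b c d :=
  forall s t, a <= s <= b -> c <= t <= d -> closed_at s t.

Lemma closed_rectS a b c d a' b' c' d' :
  a <= a' -> b' <= b -> c <= c' -> d' <= d ->
  closed_rect a b c d -> closed_rect a' b' c' d'.
Proof.
move=> aa bb cc dd H s t /andP[s1 s2] /andP[t1 t2]; apply: H.
- by rewrite (le_trans aa)// (le_trans s2).
- by rewrite (le_trans cc)// (le_trans t2).
Qed.

Lemma closed_rect_contP a b c d t : closed_rect a b c d -> c <= t <= d ->
  cont_on (P ^~ t) a b.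
Proof. by move=> H tcd s sab; have [] := closed_at_cont (H _ _ sab tcd). Qed.

Lemma closed_rect_contQ a b c d s : closed_rect a b c d -> a <= s <= b ->
  cont_on (Q s) c d.
Proof. by move=> H sab t tcd; have [] := closed_at_cont (H _ _ sab tcd). Qed.

Lemma circ_quarter a b c d m n : a <= m <= b -> c <= n <= d ->
  closed_rect a b c d ->
  circ a b c d = circ a m c n + circ m b c n + circ a m n d + circ m b n d.
Proof.
move=> /andP[am mb] /andP[cn nd] H; rewrite /circ.
have ab := le_trans am mb; have cd := le_trans cn nd.
have cP t : c <= t <= d -> fint (P ^~ t) a b = fint (P ^~ t) a m + fint (P ^~ t) m b.
  by move=> /(closed_rect_contP H) /(fint_split am mb).
have cQ s : a <= s <= b -> fint (Q s) c d = fint (Q s) c n + fint (Q s) n d.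
  by move=> /(closed_rect_contQ H) /(fint_split cn nd).
rewrite !cP ?lexx ?cd// !cQ ?lexx ?ab//.
ring.
Qed.

(* On a rectangle shrinking to a point, the affine part of the closed form has
   no circulation, so only the differentiability error survives. *)
Lemma circ_small s t : closed_at s t -> forall e, 0 < e -> exists2 del, 0 < del &
  forall a w h c, 0 < w -> 0 < h -> w <= del -> h <= del ->
    a <= s <= a + w -> c <= t <= c + h -> closed_rect a (a + w) c (c + h) ->
    `|circ a (a + w) c (c + h)| <= 2 * e * (w + h) ^+ 2.
Proof.
move=> [A [B [C [dP dQ]]]] e e0.
have [d1 d10 HP] := dP _ e0; have [d2 d20 HQ] := dQ _ e0.
exists (Num.min d1 d2); first by rewrite lt_min d10.
move=> a w h c w0 h0; rewrite !le_min => /andP[w1 w2] /andP[h1 h2].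
move=> /andP[s1 s2] /andP[t1 t2] H.
have aw : a <= a + w by rewrite lerDl ltW.
have ch : c <= c + h by rewrite lerDl ltW.
have nearw s' : a <= s' <= a + w -> `|s' - s| <= w by rewrite ler_norml; lra.
have nearh t' : c <= t' <= c + h -> `|t' - t| <= h by rewrite ler_norml; lra.
have bQ s' t' : a <= s' <= a + w -> c <= t' <= c + h ->
    `|Q s' t' - Q s t - B * (s' - s) - C * (t' - t)| <= e * (w + h).
  move=> /nearw sw /nearh th; apply: le_trans (HQ _ _ _ _) _.
  - exact: le_trans sw w2.
  - exact: le_trans th h2.
  - by rewrite ler_pM2l// lerD.
have bP s' t' : a <= s' <= a + w -> c <= t' <= c + h ->
    `|P s' t' - P s t - A * (s' - s) - B * (t' - t)| <= e * (w + h).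
  move=> /nearw sw /nearh th; apply: le_trans (HP _ _ _ _) _.
  - exact: le_trans sw w1.
  - exact: le_trans th h1.
  - by rewrite ler_pM2l// lerD.
have iQ : `|fint (Q (a + w)) c (c + h) - fint (Q a) c (c + h) - B * w * h| <=
    2 * e * (w + h) * h.
  have c1 : cont_on (Q (a + w)) c (c + h) by apply: closed_rect_contQ H _; rewrite
      lexx aw.
  have c2 : cont_on (Q a) c (c + h) by apply: closed_rect_contQ H _; rewrite lexx aw.
  rewrite /fint -RintegralB//; [|exact: cont_on_integrable..].
  have := @fint_near (fun t => Q (a + w) t - Q a t) (B * w) (2 * e * (w + h)) c (c
      + h) ch.
  rewrite (addrC c h) addrK; rewrite (addrC h c); apply.
    by move=> x xc; apply: continuousB; [exact: c1|exact: c2].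
  move=> x xc.
  have := bQ a x; rewrite lexx aw => /(_ isT xc).
  have := bQ (a + w) x; rewrite lexx aw => /(_ isT xc).
  rewrite !ler_norml; lra.
have iP : `|fint (P ^~ (c + h)) a (a + w) - fint (P ^~ c) a (a + w) - B * h * w| <=
    2 * e * (w + h) * w.
  have c1 : cont_on (P ^~ (c + h)) a (a + w) by apply: closed_rect_contP H _;
      rewrite lexx ch.
  have c2 : cont_on (P ^~ c) a (a + w) by apply: closed_rect_contP H _; rewrite lexx ch.
  rewrite /fint -RintegralB//; [|exact: cont_on_integrable..].
  have := @fint_near (fun x => P x (c + h) - P x c) (B * h) (2 * e * (w + h)) a (a
      + w) aw.
  rewrite (addrC a w) addrK; rewrite (addrC w a); apply.
    by move=> x xc; apply: continuousB; [exact: c1|exact: c2].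
  move=> x xc.
  have := bP x c; rewrite lexx ch => /(_ xc isT).
  have := bP x (c + h); rewrite lexx ch => /(_ xc isT).
  rewrite !ler_norml; lra.
(* Both pairs of opposite sides have the same main term [B * w * h], so it cancels in [circ]. *)
rewrite /circ; move: iQ iP.
move: (_ - fint (Q a) _ _) (_ - fint (P ^~ c) _ _) => u v.
have -> : 2 * e * (w + h) ^+ 2 = 2 * e * (w + h) * h + 2 * e * (w + h) * w by ring.
have -> : B * h * w = B * w * h by ring.
move: (2 * e * (w + h) * h) (2 * e * (w + h) * w) => p q.
rewrite !ler_norml; lra.
Qed.

Lemma goursat a w c h : 0 < w -> 0 < h -> closed_rect a (a + w) c (c + h) ->
  circ a (a + w) c (c + h) = 0.
Proof.
move=> w0 h0 H; apply/eqP/negPn/negP => K0.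
pose K := `|circ a (a + w) c (c + h)|.
have {K0} K0 : 0 < K by rewrite normr_gt0.
pose W n : R := w / 2 ^+ n; pose H_ n : R := h / 2 ^+ n.
have W0 n : 0 < W n by rewrite divr_gt0// exprn_gt0.
have H0 n : 0 < H_ n by rewrite divr_gt0// exprn_gt0.
have WS n : W n = W n.+1 + W n.+1 by rewrite /W exprS; field; rewrite expf_neq0.
have HS n : H_ n = H_ n.+1 + H_ n.+1 by rewrite /H_ exprS; field; rewrite expf_neq0.
(* Invariant of the bisection: the [n]-th rectangle, with lower left corner [q], stays in the first
   one and keeps at least the fraction [1 / 4 ^+ n] of its circulation. *)
pose inv n (q : R * R) := [/\ a <= q.1, q.1 + W n <= a + w, c <= q.2, q.2 + H_ n <=
    c + h &
  K / 4 ^+ n <= `|circ q.1 (q.1 + W n) q.2 (q.2 + H_ n)|].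
have step n q : inv n q -> exists q', [/\ inv n.+1 q',
   q.1 <= q'.1, q'.1 + W n.+1 <= q.1 + W n, q.2 <= q'.2 & q'.2 + H_ n.+1 <= q.2 + H_ n].
  case: q => x y; rewrite /inv/= => -[x1 x2 y1 y2 k].
  have W1 := W0 n.+1; have H1 := H0 n.+1; have WSn := WS n; have HSn := HS n.
  have Hxy : closed_rect x (x + W n) y (y + H_ n) by apply: closed_rectS H.
  move: k; have := @circ_quarter x (x + W n) y (y + H_ n) (x + W n.+1) (y + H_
      n.+1) _ _ Hxy.
  have -> : x + W n = (x + W n.+1) + W n.+1 by rewrite WSn addrA.
  have -> : y + H_ n = (y + H_ n.+1) + H_ n.+1 by rewrite HSn addrA.
  move=> -> //; [|lra|lra].
  have : K / 4 ^+ n.+1 = 4^-1 * (K / 4 ^+ n) by rewrite exprS invfM mulrCA.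
  move: (K / 4 ^+ n) => k kE k4; move: W1 H1 WSn HSn; rewrite /inv kE.
  move: (W n) (W n.+1) (H_ n) (H_ n.+1) x2 y2 k4 => Wn W' Hn H' x2 y2 k4 W1 H1 WSn HSn.
  have [q1|q1] := lerP (4^-1 * k) `|circ x (x + W') y (y + H')|.
    exists (x, y); split=> /=; [split=> //; lra|lra..].
  have [q2|q2] := lerP (4^-1 * k) `|circ (x + W') (x + W' + W') y (y + H')|.
    exists (x + W', y); split=> /=; [split=> //; lra|lra..].
  have [q3|q3] := lerP (4^-1 * k) `|circ x (x + W') (y + H') (y + H' + H')|.
    exists (x, y + H'); split=> /=; [split=> //; lra|lra..].
  have [q4|q4] := lerP (4^-1 * k) `|circ (x + W') (x + W' + W') (y + H') (y + H' + H')|.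
    exists (x + W', y + H'); split=> /=; [split=> //; lra|lra..].
  (* If every quarter had less than [k / 4], the whole rectangle would have less than [k]. *)
  exfalso; move: k4 q1 q2 q3 q4.
  move: (circ _ _ _ _) (circ _ _ _ _) (circ _ _ _ _) (circ _ _ _ _) => z1 z2 z3 z4.
  move=> k4 q1 q2 q3 q4.
  suff : `|z4 + z3 + z2 + z1| < k by rewrite ltNge k4.
  by move: q1 q2 q3 q4 {k4}; rewrite !ltr_norml; lra.
(* The depth is stored with the corner, so that the invariant lives in one fixed type on which
   dependent choice can iterate. *)
pose T := {q : nat * (R * R) | inv q.1 q.2}.
pose Rel (p q : T) := [/\ (sval q).1 = (sval p).1.+1,
  (sval p).2.1 <= (sval q).2.1,
  (sval q).2.1 + W (sval q).1 <= (sval p).2.1 + W (sval p).1,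
  (sval p).2.2 <= (sval q).2.2 &
  (sval q).2.2 + H_ (sval q).1 <= (sval p).2.2 + H_ (sval p).1].
have inv0 : inv 0%N (a, c).
  by rewrite /inv/= /W /H_ expr0 !divr1; split.
have RelP (p : T) : {q : T | Rel p q}.
  apply: cid; case: p => -[n p] /= ip; have [q [iq q1 q2 q3 q4]] := step n p ip.
  by exists (exist (fun z : nat * (R * R) => inv z.1 z.2) (n.+1, q) iq).
have [f [f0 fS]] := dependent_choice RelP (exist (fun z : nat * (R * R) => inv z.1
    z.2) (0%N, (a, c)) inv0).
have fn n : (sval (f n)).1 = n.
  by elim: n => [|n IH]; [rewrite f0|have [-> _ _ _ _] := fS n; rewrite IH].
pose x n := (sval (f n)).2.1; pose y n := (sval (f n)).2.2.
have fi n : inv n (x n, y n).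
  by have := svalP (f n); rewrite fn /x /y; case: (sval (f n)).2.
have xS n : x n <= x n.+1 /\ x n.+1 + W n.+1 <= x n + W n.
  by have [_ A1 A2 _ _] := fS n; rewrite /x; move: A1 A2; rewrite !fn.
have yS n : y n <= y n.+1 /\ y n.+1 + H_ n.+1 <= y n + H_ n.
  by have [_ _ _ A1 A2] := fS n; rewrite /y; move: A1 A2; rewrite !fn.
have lim (z V : nat -> R) : (forall n, 0 < V n) ->
    (forall n, z n <= z n.+1 /\ z n.+1 + V n.+1 <= z n + V n) ->
    exists l, forall n, z n <= l <= z n + V n.
  move=> V0 zS.
  have z1 n k : z n <= z (n + k)%N.
    by elim: k => [|k IH]; [rewrite addn0|rewrite addnS (le_trans IH)//; have [] :=
        zS (n + k)%N].
  have z2 n k : z (n + k)%N + V (n + k)%N <= z n + V n.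
    by elim: k => [|k IH]; [rewrite addn0|rewrite addnS; apply: le_trans IH; have
        [] := zS (n + k)%N].
  have z3 n k : z k <= z n + V n.
    have [nk|kn] := leqP n k.
      have := z2 n (k - n)%N; rewrite subnKC//; apply: le_trans.
      by rewrite lerDl ltW.
    apply: (@le_trans _ _ (z n)); last by rewrite lerDl ltW.
    by have := z1 k (n - k)%N; rewrite subnKC// ltnW.
  (* Nested intervals: by [z3] each right end bounds all left ends, so the supremum of the left ends
     lies in every interval. *)
  exists (sup (range z)) => n; apply/andP; split.
    apply: ub_le_sup; last by exists n.
    by exists (z 0%N + V 0%N) => _ [k _ <-].
  by apply: ge_sup; [exists (z 0%N), 0%N|move=> _ [k _ <-]].
have [s sP] := lim x W W0 xS; have [t tP] := lim y H_ H0 yS.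
have st : closed_at s t.
  by apply: H; [have := sP 0%N|have := tP 0%N]; have [/= + + + + _] := fi 0%N; lra.
(* With this [e] the bound of [circ_small] at depth [n] is half of [K / 4 ^+ n], which contradicts
   the invariant. *)
pose e := K / (4 * (w + h) ^+ 2).
have wh0 : 0 < w + h by exact: addr_gt0.
have e0 : 0 < e by rewrite divr_gt0// mulr_gt0// exprn_gt0.
have [del del0 D] := circ_small st e0.
have [n Wn Hn] : exists2 n, W n <= del & H_ n <= del.
  pose n := (Num.truncn ((w + h) / del)).+1.
  have nP : (w + h) / del <= n%:R by exact/ltW/truncnS_gt.
  have n2 : w + h <= del * 2 ^+ n.
    rewrite mulrC -ler_pdivrMr// (le_trans nP)// -natrX ler_nat.
    exact/ltnW/ltn_expl.
  by exists n; rewrite ler_pdivrMr ?exprn_gt0//; apply: le_trans n2; rewrite ?lerDl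
      ?lerDr ltW.
have [/= a1 a2 a3 a4] := fi n.
have := D (x n) (W n) (H_ n) (y n) (W0 n) (H0 n) Wn Hn (sP n) (tP n).
move=> /(_ (closed_rectS a1 a2 a3 a4 H)) A1 A2.
have := le_trans A2 A1.
have -> : 2 * e * (W n + H_ n) ^+ 2 = K / 4 ^+ n / 2.
  rewrite /e /W /H_ -mulrDl expr_div_n -exprM mulnC exprM.
  rewrite (_ : 2 ^+ 2 = 4 :> R); last by ring.
  by field; rewrite expf_neq0//= gt_eqF.
have : 0 < K / 4 ^+ n by rewrite divr_gt0// exprn_gt0.
lra.
Qed.

End rectangle.
End Goursat.

(** * Cauchy-Riemann pairs and the circle mean value property *)

Section MeanValue.
Variable R : realType.
Implicit Types (s t x y e d A B : R).

Lemma cdiff_comp (U X Y : R -> R -> R) s t Ux Uy Xs Xt Ys Yt :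
  cdiff U (X s t) (Y s t) Ux Uy -> cdiff X s t Xs Xt -> cdiff Y s t Ys Yt ->
  cdiff (fun s t => U (X s t) (Y s t)) s t (Ux * Xs + Uy * Ys) (Ux * Xt + Uy * Yt).
Proof.
move=> dU dX dY e e0.
(* [L] is a Lipschitz constant of both [X] and [Y] at the point, its [+ 1] absorbing an error
   [e2 <= 1]; [M] bounds the outer differential. The total error is [EU + (Ux * EX + Uy * EY)], and
   each summand is given half of [e]. *)
pose L := `|Xs| + `|Xt| + `|Ys| + `|Yt| + 1.
have L0 : 0 < L by rewrite ltr_wpDl// !addr_ge0.
pose M := `|Ux| + `|Uy| + 1.
have M0 : 0 < M by rewrite ltr_wpDl// addr_ge0.
pose e1 := e / (4 * L); have e10 : 0 < e1 by rewrite divr_gt0// mulr_gt0.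
pose e2 := Num.min 1 (e / (2 * M)).
have e20 : 0 < e2 by rewrite lt_min ltr01 divr_gt0// mulr_gt0.
have e21 : e2 <= 1 by rewrite ge_min lexx.
have e2M : M * e2 <= e / 2.
  apply: (@le_trans _ _ (M * (e / (2 * M)))).
    by rewrite ler_pM2l// ge_min lexx orbT.
  by rewrite (_ : M * _ = e / 2)//; field; rewrite gt_eqF.
have [dU' dU0 HU] := dU _ e10.
have [d1 d10 HX] := dX _ e20; have [d2 d20 HY] := dY _ e20.
exists (Num.min (dU' / (2 * L)) (Num.min d1 d2)).
  by rewrite !lt_min d10 d20 divr_gt0// mulr_gt0.
move=> s' t'; rewrite !le_min => /and3P[sU s1 s2] /and3P[tU t1 t2].
have {HX} := HX s' t' s1 t1; have {HY} := HY s' t' s2 t2.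
set n := `|s' - s| + `|t' - t|.
have n0 : 0 <= n by rewrite addr_ge0.
have nU : L * n <= dU'.
  move: sU tU; rewrite !ler_pdivlMr ?mulr_gt0// => sU tU.
  have -> : L * n = (`|s' - s| * (2 * L) + `|t' - t| * (2 * L)) / 2 by rewrite /n;
      field.
  lra.
set EX := X s' t' - _ - _ - _; set EY := Y s' t' - _ - _ - _ => hY hX.
have en : e2 * n <= n by rewrite ler_piMl.
have bnd (Z A B E : R) : Z = E + A * (s' - s) + B * (t' - t) -> `|E| <= e2 * n ->
    `|A| + `|B| + 1 <= L -> `|Z| <= L * n.
  move=> -> hE AB; apply: (@le_trans _ _ ((`|A| + `|B| + 1) * n)); last first.
    by rewrite ler_wpM2r.
  apply: le_trans (ler_normD _ _) _; rewrite !normrM.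
  apply: (@le_trans _ _ (n + `|A| * n + `|B| * n)); last by rewrite le_eqVlt;
      apply/orP; left; apply/eqP; ring.
  apply: lerD; last by rewrite ler_wpM2l// lerDr.
  apply: le_trans (ler_normD _ _) _; rewrite normrM.
  by apply: lerD; [exact: le_trans en|rewrite ler_wpM2l// lerDl].
have bX : `|X s' t' - X s t| <= L * n.
  apply: (bnd _ Xs Xt EX) => //; first by rewrite /EX; ring.
  rewrite /L; have := normr_ge0 Ys; have := normr_ge0 Yt; lra.
have bY : `|Y s' t' - Y s t| <= L * n.
  apply: (bnd _ Ys Yt EY) => //; first by rewrite /EY; ring.
  rewrite /L; have := normr_ge0 Xs; have := normr_ge0 Xt; lra.
have := HU _ _ (le_trans bX nU) (le_trans bY nU).
set EU := _ - _ - _ - _ => hU.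
have -> : U (X s' t') (Y s' t') - U (X s t) (Y s t) - (Ux * Xs + Uy * Ys) * (s' - s)
    - (Ux * Xt + Uy * Yt) * (t' - t) = EU + (Ux * EX + Uy * EY).
  by rewrite /EU /EX /EY; ring.
have h1 : `|EU| <= e / 2 * n.
  apply: le_trans hU _; apply: (@le_trans _ _ (e1 * (L * n + L * n))).
    by rewrite ler_pM2l// lerD.
  by rewrite (_ : _ * _ = e / 2 * n)// /e1; field; rewrite gt_eqF.
have h2 : `|Ux * EX + Uy * EY| <= e / 2 * n.
  apply: le_trans (ler_normD _ _) _; rewrite !normrM.
  apply: (@le_trans _ _ (M * e2 * n)); last by rewrite ler_wpM2r.
  have u1 : `|Ux| * `|EX| <= `|Ux| * (e2 * n) by rewrite ler_wpM2l.
  have u2 : `|Uy| * `|EY| <= `|Uy| * (e2 * n) by rewrite ler_wpM2l.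
  have u3 : 0 <= e2 * n by rewrite mulr_ge0// ltW.
  have -> : M * e2 * n = `|Ux| * (e2 * n) + `|Uy| * (e2 * n) + e2 * n by rewrite
      /M; ring.
  lra.
apply: le_trans (ler_normD _ _) _.
have -> : e * n = e / 2 * n + e / 2 * n by field.
exact: lerD.
Qed.

Lemma cdiffE U s t A B A' B' : A = A' -> B = B' -> cdiff U s t A B -> cdiff U s t A' B'.
Proof. by move=> -> ->. Qed.

Lemma cdiff_affine (k A B s t : R) : cdiff (fun s t => k + A * s + B * t) s t A B.
Proof.
move=> e e0; exists 1 => // s' t' _ _.
rewrite (_ : _ - _ - _ - _ = 0); last by ring.
by rewrite normr0 mulr_ge0 ?addr_ge0// ltW.
Qed.

Lemma cdiff_cst (k s t : R) : cdiff (fun _ _ => k) s t 0 0.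
Proof.
have := cdiff_affine k 0 0 s t; congr cdiff.
by apply/funext => ?; apply/funext => ?; ring.
Qed.

Lemma cdiff_fst s t : cdiff (fun s _ => s) s t 1 0.
Proof.
have := cdiff_affine 0 1 0 s t; congr cdiff.
by apply/funext => ?; apply/funext => ?; ring.
Qed.

Lemma cdiff_snd s t : cdiff (fun _ t => t) s t 0 1.
Proof.
have := cdiff_affine 0 0 1 s t; congr cdiff.
by apply/funext => ?; apply/funext => ?; ring.
Qed.

Lemma cdiff_mulfun x y : cdiff (fun x y => x * y) x y y x.
Proof.
move=> e e0; exists e => // x' y' xe ye.
rewrite (_ : _ - _ - _ - _ = (x' - x) * (y' - y)); last by ring.
rewrite normrM mulrDr (le_trans (_ : _ <= `|x' - x| * e))//.
  by rewrite ler_wpM2l.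
by rewrite mulrC lerDl mulr_ge0// ltW.
Qed.

Lemma cdiffM U V s t A B A' B' : cdiff U s t A B -> cdiff V s t A' B' ->
  cdiff (fun s t => U s t * V s t) s t (V s t * A + U s t * A') (V s t * B + U s t
      * B').
Proof. by move=> dU dV; apply: (cdiff_comp (cdiff_mulfun _ _)). Qed.

Lemma cdiffD U V s t A B A' B' : cdiff U s t A B -> cdiff V s t A' B' ->
  cdiff (fun s t => U s t + V s t) s t (A + A') (B + B').
Proof.
move=> dU dV; have := cdiff_comp (cdiff_affine 0 1 1 _ _) dU dV.
rewrite !mul1r; congr cdiff; apply/funext => ?; apply/funext => ?; ring.
Qed.

Lemma cdiffN U s t A B : cdiff U s t A B -> cdiff (fun s t => - U s t) s t (- A) (- B).
Proof.
move=> dU; have := cdiff_comp (cdiff_affine 0 (-1) 0 _ _) dU dU.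
rewrite !mulN1r !mul0r !addr0; congr cdiff; apply/funext => ?; apply/funext => ?; ring.
Qed.

Lemma is_derive_cdiff1 (g : R -> R) s t D : is_derive s 1 g D -> cdiff (fun s _ =>
    g s) s t D 0.
Proof.
move=> /is_derive1_caratheodory[k [kE kc <-]] e e0.
have [d /= d0 kd] : \forall z \near s, `|k s - k z| <= e.
  by move: kc => /cvgrPdist_le; exact.
exists (d / 2); first by rewrite divr_gt0.
move=> s' t' sd _; rewrite kE mul0r subr0 -mulrBl normrM.
apply: (@le_trans _ _ (e * `|s' - s|)); last by rewrite ler_pM2l// lerDl.
rewrite ler_wpM2r// distrC; apply: kd => /=; rewrite distrC.
by rewrite (le_lt_trans sd)// ltr_pdivrMr// ltr_pMr// ltr1n.
Qed.

Lemma is_derive_cdiff2 (g : R -> R) s t D : is_derive t 1 g D -> cdiff (fun _ t =>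
    g t) s t 0 D.
Proof. by move=> /(is_derive_cdiff1 s)/cdiff_swap. Qed.

(** [A + i B] is the complex derivative of [U + i V] at [x + i y]. *)
Definition CR (U V : R -> R -> R) x y :=
  exists A B, cdiff U x y A (- B) /\ cdiff V x y B A.

Lemma CR_mul U V U' V' x y : CR U V x y -> CR U' V' x y ->
  CR (fun x y => U x y * U' x y - V x y * V' x y)
     (fun x y => U x y * V' x y + V x y * U' x y) x y.
Proof.
move=> [A [B [dU dV]]] [A' [B' [dU' dV']]].
exists (U' x y * A + U x y * A' - V' x y * B - V x y * B').
exists (V' x y * A + U x y * B' + U' x y * B + V x y * A'); split.
- by apply: cdiffE (cdiffD (cdiffM dU dU') (cdiffN (cdiffM dV dV'))); ring.
- by apply: cdiffE (cdiffD (cdiffM dU dV') (cdiffM dV dU')); ring.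
Qed.

Lemma CR_add U V U' V' x y : CR U V x y -> CR U' V' x y ->
  CR (fun x y => U x y + U' x y) (fun x y => V x y + V' x y) x y.
Proof.
move=> [A [B [dU dV]]] [A' [B' [dU' dV']]]; exists (A + A'), (B + B'); split.
- by apply: cdiffE (cdiffD dU dU'); ring.
- by apply: cdiffE (cdiffD dV dV'); ring.
Qed.

Lemma CR_cst (k l x y : R) : CR (fun _ _ => k) (fun _ _ => l) x y.
Proof. by exists 0, 0; rewrite oppr0; split; exact: cdiff_cst. Qed.

Lemma CR_id x y : CR (fun x _ => x) (fun _ y => y) x y.
Proof. by exists 1, 0; rewrite oppr0; split; [exact: cdiff_fst|exact: cdiff_snd]. Qed.

(** Used with [k = -1] for the reflection [F(- z)] and with [k = 1] for translations. *)
Lemma CR_affine (k a b : R) U V x y : CR U V (a + k * x) (b + k * y) ->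
  CR (fun x y => U (a + k * x) (b + k * y)) (fun x y => V (a + k * x) (b + k * y)) x y.
Proof.
move=> [A [B [dU dV]]]; exists (A * k), (B * k).
have X : cdiff (fun x y => a + k * x) x y k 0.
  have := cdiff_affine a k 0 x y; congr cdiff.
  by apply/funext => ?; apply/funext => ?; ring.
have Y : cdiff (fun x y => b + k * y) x y 0 k.
  have := cdiff_affine b 0 k x y; congr cdiff.
  by apply/funext => ?; apply/funext => ?; ring.
have C := @cdiff_comp _ (fun x _ => a + k * x) (fun _ y => b + k * y) x y.
by split; [apply: cdiffE (C _ _ _ _ _ _ _ dU X Y)|apply: cdiffE (C _ _ _ _ _ _ _ dV
    X Y)]; ring.
Qed.

(** The division by [p] cancels the factor [p] produced by differentiating in the angle, so both
    mixed partials equal [A * cos th - B * sin th]. *)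
Lemma CR_closed_polar U V p th : p != 0 -> CR U V (p * cos th) (p * sin th) ->
  closed_at (fun p th => V (p * cos th) (p * sin th) * p^-1)
            (fun p th => U (p * cos th) (p * sin th)) p th.
Proof.
move=> p0 [A [B [dU dV]]].
have X := cdiffM (cdiff_fst p th) (is_derive_cdiff2 p (is_derive_cos th)).
have Y := cdiffM (cdiff_fst p th) (is_derive_cdiff2 p (is_derive_sin th)).
have I : cdiff (fun q (_ : R) => q^-1) p th (- (p^-1) ^+ 2) 0.
  have := is_derive_cdiff1 th (is_deriveV p0 (is_derive_id p 1)).
  by apply: cdiffE => //; rewrite exprVn /GRing.scale/= mulr1.
have C := @cdiff_comp _ (fun p th => p * cos th) (fun p th => p * sin th) p th.
have Q := C _ _ _ _ _ _ _ dU X Y.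
have P := cdiffM (C _ _ _ _ _ _ _ dV X Y) I.
eexists; exists (A * cos th - B * sin th); eexists; split.
- by apply: cdiffE P; [reflexivity|field].
- by apply: cdiffE Q; [ring|reflexivity].
Qed.

(** By Goursat the angular integral is the same on all circles of radius in []0, r[]; on a tiny
    circle it is close to [pi * U 0 0]. *)
Lemma CR_mean_value U V r : 0 < r ->
  (forall x y, x ^+ 2 + y ^+ 2 < r ^+ 2 -> CR U V x y) ->
  (forall x y, V (- x) (- y) = V x y) ->
  forall p, 0 < p -> p < r ->
    fint (fun th => U (p * cos th) (p * sin th)) (- (pi / 2)) (pi / 2) = pi * U 0 0.
Proof.
move=> r0 cr ev p p0 pr.
pose Q p th := U (p * cos th) (p * sin th).
pose P p th := V (p * cos th) (p * sin th) * p^-1.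
have pi0 := @pi_gt0 R.
have pp : pi / 2 = - (pi / 2) + pi :> R by field.
have le2 : - (pi / 2) <= pi / 2 :> R by lra.
have crp q th : 0 <= q -> q < r -> CR U V (q * cos th) (q * sin th).
  move=> q0 qr; apply: cr; rewrite !exprMn -mulrDr cos2Dsin2 mulr1.
  by rewrite ltr_pXn2r// ?nnegrE// ltW.
have indep q : 0 < q -> q < p -> fint (Q p) (- (pi / 2)) (pi / 2) = fint (Q q) (-
    (pi / 2)) (pi / 2).
  move=> q0 qp.
  have := @goursat R P Q q (p - q) (- (pi / 2)) pi; rewrite -pp (_ : q + (p - q) =
      p); last by ring.
  rewrite subr_gt0 => /(_ qp pi0) G; have /G : closed_rect P Q q p (- (pi / 2)) (pi
      / 2).
    move=> s t /andP[s1 s2] _; apply: CR_closed_polar.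
      by rewrite gt_eqF// (lt_le_trans q0).
    by apply: crp; [rewrite (le_trans (ltW q0))|exact: le_lt_trans pr].
  (* The radial sides lie over antipodal points, where the even function [V] takes equal values. *)
  rewrite /circ (_ : P ^~ (pi / 2) = P ^~ (- (pi / 2))).
    by rewrite subrr subr0 => /eqP; rewrite subr_eq0 => /eqP.
  by apply/funext => z; rewrite /P cosN sinN cos_pihalf mulr0 mulrN -[in LHS]ev oppr0.
rewrite -/(Q p); apply/eqP; rewrite -subr_eq0 -normr_le0; apply/ler_addgt0Pr => e e0.
rewrite add0r.
have /cr[A [B [dU _]]] : 0 ^+ 2 + 0 ^+ 2 < r ^+ 2.
  by rewrite expr0n/= addr0 exprn_gt0.
have [d d0 H] := dU 1 ltr01.
(* Differentiability at the origin with error [1] gives [|U - U 0 0| <= q * k] on the circle of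
   radius [q <= d]; the [2] comes from [|x| + |y| <= 2 * q]. The bound [e / (pi * k)] on [q]
   accounts for the length [pi] of the angular interval. *)
pose k := `|A| + `|B| + 2; have k0 : 0 < k by rewrite ltr_wpDl ?addr_ge0.
pose q := Num.min (p / 2) (Num.min d (e / (pi * k))).
have q0 : 0 < q by rewrite !lt_min d0 !divr_gt0// mulr_gt0.
have qp : q < p by rewrite gt_min ltr_pdivrMr// ltr_pMr// ltr1n.
have qd : q <= d by rewrite !ge_min lexx orbT.
have qe : q * k * pi <= e.
  have : q <= e / (pi * k) by rewrite !ge_min lexx !orbT.
  by rewrite ler_pdivlMr ?mulr_gt0// (mulrC pi) mulrA.
rewrite (indep q)//.
have pB : pi / 2 - - (pi / 2) = pi :> R by field.
have := @fint_near R (Q q) (U 0 0) (q * k) _ _ le2; rewrite pB (mulrC (U 0 0)) =>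
    /(_ _ _)/le_trans.
apply => //.
  move=> th _; have qN : q != 0 by rewrite gt_eqF.
  have /(CR_closed_polar qN)/closed_at_cont[] // := crp q th (ltW q0) (lt_trans qp pr).
move=> th _.
have c1 : `|q * cos th| <= q.
  rewrite normrM gtr0_norm//; apply: ler_piMr; first exact: ltW.
  by rewrite ler_norml cos_geN1 cos_le1.
have s1 : `|q * sin th| <= q.
  rewrite normrM gtr0_norm//; apply: ler_piMr; first exact: ltW.
  by rewrite ler_norml sin_geN1 sin_le1.
have := H (q * cos th) (q * sin th); rewrite !subr0 mul1r => /(_ (le_trans c1 qd)
    (le_trans s1 qd)).
rewrite -/(Q q th); move: (Q q th) (U 0 0) => u v hu.
have -> : u - v = (u - v - A * (q * cos th) - (- B) * (q * sin th)) + (A * (q * cos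
    th) - B * (q * sin th)) by ring.
apply: le_trans (ler_normD _ _) _.
have h1 : `|A * (q * cos th) - B * (q * sin th)| <= `|A| * q + `|B| * q.
  apply: le_trans (ler_normB _ _) _.
  by rewrite !(normrM A, normrM B) lerD// ler_wpM2l.
have -> : q * k = q + q + (`|A| * q + `|B| * q) by rewrite /k; ring.
apply: lerD h1; apply: le_trans hu _; exact: lerD.
Qed.
End MeanValue.

(** * Polar coordinates *)

Section Polar.
Variable R : realType.
Notation mu := (@lebesgue_measure R).

(** The boxes with rational corners contained in [O] cover it, and there are countably many of
    them. *)
Lemma open2_measurable (O : set (R * R)) : open O -> measurable O.
Proof.
move=> oO.
pose box (q : (rat * rat) * (rat * rat)) : set (R * R) :=
  `]ratr q.1.1, ratr q.1.2[%classic `*` `]ratr q.2.1, ratr q.2.2[%classic.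
have -> : O = \bigcup_(q in [set q | box q `<=` O]) box q.
  apply/seteqP; split => [[x y] Oxy|p [q /= + bp]]; last exact.
  have /nbhs_ballP[e /= e0 eO] : nbhs (x, y) O by exact: open_nbhs_nbhs.
  have xe1 : x - e < x by rewrite ltrBlDr ltrDl.
  have xe2 : x < x + e by rewrite ltrDl.
  have ye1 : y - e < y by rewrite ltrBlDr ltrDl.
  have ye2 : y < y + e by rewrite ltrDl.
  have [q1] := rat_in_itvoo xe1; have [q2] := rat_in_itvoo xe2.
  have [q3] := rat_in_itvoo ye1; have [q4] := rat_in_itvoo ye2.
  rewrite !in_itv/= => /andP[h1 h2] /andP[h3 h4] /andP[h5 h6] /andP[h7 h8].
  exists ((q1, q2), (q3, q4)); last by rewrite /box/=; split; rewrite /= in_itv/=;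
      apply/andP.
  move=> [x' y'] [/=]; rewrite !in_itv/= => /andP[a1 a2] /andP[a3 a4].
  by apply: eO; split; rewrite /ball/= ltr_norml; lra.
rewrite bigcup_mkcond; apply: countable_bigcupT_measurable => [|q].
  exact: countableP.
by case: ifPn => // _; apply: measurableX; exact: measurable_itv.
Qed.

Lemma open2_continuous_measurable (D : set (R * R)) (f : R * R -> R) :
  open D -> (forall p, D p -> {for p, continuous f}) -> measurable_fun D f.
Proof.
move=> oD cf; apply: (measurability _ (RGenOpens.measurableE R)) => //.
move=> _ [_ [a [b ->] <-]]; apply: open2_measurable.
rewrite openE => p [Dp /= fp].
rewrite /interior; apply: filterI; first exact: open_nbhs_nbhs.
by apply: cf => //; apply: open_nbhs_nbhs; split => //; exact: interval_open.
Qed.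

Local Open Scope ereal_scope.

(** The push-forward of Lebesgue measure by the affine map, scaled by [|c|], agrees with Lebesgue
    measure on half-open intervals, hence everywhere. *)
Lemma ge0_integral_affine (k : R -> \bar R) (b c : R) : c != 0%R ->
  measurable_fun setT k -> (forall x, 0 <= k x) ->
  \int[mu]_x k x = `|c|%:E * \int[mu]_x k (b + c * x)%R.
Proof.
move=> c0 mk k0.
pose h : measurableTypeR R -> measurableTypeR R := fun x => (b + c * x)%R.
have mh : measurable_fun setT h.
  by apply: measurable_funD => //; apply: measurable_funM.
pose cn : {nonneg R} := NngNum (normr_ge0 c).
pose nu' : {measure set _ -> \bar R} := mscale cn (pushforward mu h).
pose nu := nu' mh.
have E A : measurable A -> mu A = nu A.
  apply: lebesgue_measure_unique => _ [[x y] _ <-].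
  rewrite /nu/= /nu'/= /mscale/= /pushforward.
  (* For negative [c] the preimage of a left-open interval is right-open, hence the two
     computations. *)
  have [cp|cn0|/eqP] := ltrgtP c 0%R; last by rewrite (negbTE c0).
  - rewrite (_ : h @^-1` _ = `[((y - b) / c)%R, ((x - b) / c)%R[%classic); last first.
      apply/seteqP; split => z /=; rewrite /h !in_itv/=.
        by rewrite ler_ndivrMr// ltr_ndivlMr//; lra.
      by rewrite ler_ndivrMr// ltr_ndivlMr//; lra.
    rewrite !lebesgue_measure_itv/= !lte_fin.
    rewrite ltr_nM2r ?invr_lt0// ltrD2r; case: ifP => xy; last by rewrite mule0.
    by rewrite -!EFinB -EFinM ltr0_norm//; congr EFin; field.
  - rewrite (_ : h @^-1` _ = `]((x - b) / c)%R, ((y - b) / c)%R]%classic); last first.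
      apply/seteqP; split => z /=; rewrite /h !in_itv/=.
        by rewrite ler_pdivlMr// ltr_pdivrMr//; lra.
      by rewrite ler_pdivlMr// ltr_pdivrMr//; lra.
    rewrite !lebesgue_measure_itv/= !lte_fin.
    rewrite ltr_pM2r ?invr_gt0// ltrD2r; case: ifP => xy; last by rewrite mule0.
    by rewrite -!EFinB -EFinM gtr0_norm//; congr EFin; field.
rewrite (eq_measure_integral nu); last by move=> A mA _; exact: E.
by rewrite /nu /nu' ge0_integral_mscale//= ge0_integral_pushforward.
Qed.

Lemma measurable_comp_pair d (T : measurableType d) (k : R * R -> \bar R) (f g : T
    -> R) :
  measurable_fun setT k -> measurable_fun setT f -> measurable_fun setT g ->
  measurable_fun setT (fun x => k (f x, g x)).
Proof.
move=> mk mf mg; apply: (measurableT_comp mk).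
exact: (@measurable_fun_pair _ _ _ _ (measurableTypeR R) (measurableTypeR R)).
Qed.

(** For [p = (r, u)] with [u = tan theta], the point is [(r cos theta, r sin theta)] and the factor
    is the Jacobian: [|r| dtheta = |r| / (1 + u^2) du]. *)
Definition polar_density (k : R * R -> \bar R) (p : R * R) : \bar R :=
  (`|p.1| / (1 + p.2 ^+ 2))%:E *
  k (p.1 / Num.sqrt (1 + p.2 ^+ 2), p.1 * p.2 / Num.sqrt (1 + p.2 ^+ 2))%R.

Let c (u : R) : R := ((Num.sqrt (1 + u ^+ 2))^-1)%R.

Let u0 u : (0 < 1 + u ^+ 2 :> R)%R. Proof. by rewrite ltr_pwDl// sqr_ge0. Qed.

Let cc u : (c u * c u = (1 + u ^+ 2)^-1)%R.
Proof. by rewrite -expr2 exprVn sqr_sqrtr// ltW. Qed.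

Let mfst : measurable_fun setT (fst : R * R -> R).
Proof. exact: measurable_fst. Qed.

Let msnd : measurable_fun setT (snd : R * R -> R).
Proof. exact: measurable_snd. Qed.

Lemma polar_density_ge0 k p : (forall p, 0 <= k p) -> 0 <= polar_density k p.
Proof. by move=> k0; rewrite mule_ge0// lee_fin divr_ge0// ltW. Qed.

Lemma measurable_polar_density k :
  measurable_fun setT k -> measurable_fun setT (polar_density k).
Proof.
move=> mk.
have mc : measurable_fun setT c.
  apply: continuous_measurable_fun => u; apply: cvgV; first by rewrite gt_eqF//
      sqrtr_gt0.
  apply: (cvg_comp (fun u : R => 1 + u ^+ 2)%R (@Num.sqrt R)); last exact:
      sqrt_continuous.
  by apply: cvgD; [exact: cvg_cst|exact: exprn_continuous].
have mc2 : measurable_fun setT (fun p : R * R => c p.2) by exact: measurableT_comp.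
apply: emeasurable_funM; last first.
  apply: measurable_comp_pair => //; apply: measurable_funM => //.
  exact: measurable_funM.
under eq_fun do rewrite -cc.
apply/measurable_EFinP; apply: measurable_funM; first exact: measurableT_comp.
exact: measurable_funM.
Qed.

(* Polar coordinates with the slope u = tan theta as angular variable and a
   signed radius: only linear substitutions in one variable are needed. *)
Lemma ge0_integral_polar (k : R * R -> \bar R) :
  measurable_fun setT k -> (forall p, 0 <= k p) ->
  \int[@leb2 R]_p k p =
  \int[mu]_r \int[mu]_u polar_density k (r, u).
Proof.
move=> mk k0; rewrite /leb2 fubini_tonelli1//.
pose k1 (p : R * R) := `|p.1|%:E * k (p.1, p.1 * p.2)%R.
have mk1 : measurable_fun setT k1.
  apply: emeasurable_funM; first exact/measurable_EFinP/measurableT_comp.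
  by apply: measurable_comp_pair => //; exact: measurable_funM.
have k10 p : 0 <= k1 p by rewrite mule_ge0.
transitivity (\int[mu]_x \int[mu]_u k1 (x, u)).
  apply: ge0_ae_eq_integral => //.
  - exact: measurable_fun_fubini_tonelli_F.
  - exact: measurable_fun_fubini_tonelli_F.
  - by move=> x _; exact: integral_ge0.
  - by move=> x _; exact: integral_ge0.
  (* The substitution [y = x * u] fails only on the column [x = 0], a null set. *)
  - exists [set 0%R]; split => //; first exact: lebesgue_measure_set1.
    move=> x /= /not_implyP[_]; apply: contra_notP => /eqP x0.
    rewrite /fubini_F (@ge0_integral_affine (fun y => k (x, y)) 0 x)//; last first.
      exact: measurable_comp_pair.
    rewrite -ge0_integralZl//; last first.
      by apply: measurable_comp_pair => //; apply: measurable_funD => //; apply: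
          measurable_funM.
    by apply: eq_integral => u _; rewrite /k1 add0r.
transitivity (\int[mu]_u \int[mu]_x k1 (x, u)).
  exact: (@fubini_tonelli _ _ (measurableTypeR R) (measurableTypeR R) R mu mu k1
      mk1 k10).
have c0 u : (0 < c u)%R by rewrite invr_gt0 sqrtr_gt0.
pose k2 := polar_density k.
have mk2 : measurable_fun setT k2 := measurable_polar_density mk.
have k20 p : 0 <= k2 p by exact: polar_density_ge0.
transitivity (\int[mu]_u \int[mu]_r k2 (r, u)); last first.
  exact/esym/(@fubini_tonelli _ _ (measurableTypeR R) (measurableTypeR R) R mu mu
      k2 mk2 k20).
(* On the line of slope [u] the abscissa is [x = c u * r], with [r] the signed distance to the
   origin. *)
apply: eq_integral => u _.
rewrite (@ge0_integral_affine (fun x => k1 (x, u)) 0 (c u)) ?gt_eqF//; last exact: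
    measurable_fun_pair1.
rewrite -ge0_integralZl//; last first.
  apply: (measurableT_comp (measurable_fun_pair1 u mk1)).
  by apply: measurable_funD => //; apply: measurable_funM.
apply: eq_integral => r _; rewrite /k1/= add0r muleA -EFinM /k2 /polar_density/=.
congr (_%:E * k (_, _)).
- by rewrite normrM gtr0_norm// mulrA cc mulrC.
- by rewrite mulrC.
- by rewrite /c -mulrA mulrC.
Qed.

End Polar.

(** * From the angle to the slope by the arctangent *)

Section ArctanSubstitution.
Variable R : realType.
Notation mu := (@lebesgue_measure R).

Lemma sin_atan (u : R) : sin (atan u) = u / Num.sqrt (1 + u ^+ 2).
Proof.
have c0 : cos (atan u) != 0.
  by rewrite gt_eqF// cos_gt0_pihalf// atan_gtNpi2 atan_ltpi2.
by rewrite -cos_atan -{2}(atanK u) /tan divfK.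
Qed.

Lemma EFin_fint (f : R -> R) a b : cont_on f a b ->
  ((fint f a b)%:E = \int[mu]_(x in `[a, b]) (f x)%:E)%E.
Proof.
move=> cf; rewrite /fint /Rintegral fineK//.
exact: (integrable_fin_num _ (cont_on_integrable cf)).
Qed.

Lemma fint_atan (h : R -> R) (b : R) : continuous h -> 0 <= b ->
  ((fint h (- atan b) (atan b))%:E =
   \int[mu]_(u in `[(- b)%R, b]) (h (atan u) / (1 + u ^+ 2))%:E)%E.
Proof.
move=> ch b0; rewrite EFin_fint; last by move=> x _; exact: ch.
have cD : continuous (derive1 (@atan R)).
  rewrite (_ : derive1 (@atan R) = fun x => (1 + x ^+ 2)^-1); last first.
    by apply/funext => x; exact: derive1_atan.
  move=> x; apply: cvgV; first by rewrite gt_eqF// ltr_pwDl// sqr_ge0.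
  by apply: cvgD; [exact: cvg_cst|exact: exprn_continuous].
have ca : continuous (@atan R) by move=> x; exact: continuous_atan.
rewrite -atanN integration_by_substitution_increasing//.
- by apply: eq_integral => u _; rewrite -(derive1_atan u).
- by rewrite (le_trans _ b0)// oppr_le0.
- by move=> x y _ _; exact: lt_atan.
- by apply/cvg_ex; exists (derive1 (@atan R) (- b)); apply: cvg_at_right_filter;
    exact: cD.
- by apply/cvg_ex; exists (derive1 (@atan R) b); apply: cvg_at_left_filter; exact: cD.
- split.
  + by move=> x _; exact: derivable_atan.
  + by apply: cvg_at_right_filter; exact: ca.
  + by apply: cvg_at_left_filter; exact: ca.
- by apply: continuous_subspaceT.
Qed.

(** An inequality suffices for a lower bound on the norm: the substitution is made on the compact
    interval [[- be, be]], and the two end pieces of length [d] cost at most [e]. *)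
Lemma fint_le_atan (h : R -> R) : continuous h -> (forall t, 0 <= h t) ->
  ((fint h (- (pi / 2)) (pi / 2))%:E <=
   \int[mu]_u (h (atan u) / (1 + u ^+ 2))%:E)%E.
Proof.
move=> ch h0; have pi0 := @pi_gt0 R.
have co a b : cont_on h a b by move=> x _; exact: ch.
have le2 : - (pi / 2) <= pi / 2 :> R by lra.
have [c _ hM] := EVT_max le2 (cont_on_within (co _ _)).
have mg : measurable_fun [set: R] (fun u => (h (atan u) / (1 + u ^+ 2))%:E).
  apply/measurable_EFinP; apply: continuous_measurable_fun => x; apply: cvgM.
    by apply: (continuous_comp (@continuous_atan R x)); exact: ch.
  apply: cvgV; first by rewrite gt_eqF// ltr_pwDl// sqr_ge0.
  by apply: cvgD; [exact: cvg_cst|exact: exprn_continuous].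
apply/lee_addgt0Pr => e e0.
pose M := h c + 1; have M0 : 0 < M by rewrite ltr_wpDl.
(* The first bound keeps [be] positive, the second gives [2 * M * d <= e]. *)
pose d := Num.min (pi / 4) (e / (2 * M)).
have d0 : 0 < d by rewrite lt_min !divr_gt0// mulr_gt0.
have dpi : d <= pi / 4 by rewrite ge_min lexx.
have dM : M * d + M * d <= e.
  have : d <= e / (2 * M) by rewrite ge_min lexx orbT.
  by rewrite ler_pdivlMr ?mulr_gt0//; lra.
pose be := pi / 2 - d.
have beI : be \in `](- (pi / 2)), (pi / 2)[ by rewrite in_itv/= /be; apply/andP;
    split; lra.
have be0 : 0 <= tan be.
  rewrite -tan0; have [->|be1] := eqVneq be 0; first by rewrite tan0 lexx.
  apply: ltW; rewrite ltr_tan//; first by rewrite lt_neqAle eq_sym be1 /be; lra.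
  by rewrite in_itv/=; apply/andP; split; lra.
have part a b : - (pi / 2) <= a -> b <= pi / 2 -> a <= b -> fint h a b <= M * (b - a).
  move=> aa bb ab; have := @fint_near R h 0 M a b ab (co _ _).
  rewrite mul0r subr0 ler_norml => H; suff /H/andP[] : forall x, a <= x <= b -> `|h
      x - 0| <= M by [].
  move=> x /andP[ax xb]; rewrite subr0 ger0_norm// /M; apply: le_trans (hM x _) _;
      last by rewrite lerDl.
  by rewrite in_itv/= (le_trans aa)// (le_trans xb).
have bpi : be <= pi / 2 by rewrite /be; lra.
have Nbpi : - (pi / 2) <= - be by rewrite /be; lra.
have bb : - be <= be by rewrite /be; lra.
rewrite (fint_split Nbpi _ (co _ _)); last exact: le_trans bb bpi.
rewrite (fint_split bb bpi (co _ _)).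
have p1 := part _ _ (lexx _) (le_trans bb bpi) Nbpi.
have p2 := part _ _ (le_trans Nbpi bb) (lexx _) bpi.
apply: (@le_trans _ _ ((fint h (- be) be)%:E + e%:E)%E).
  rewrite -EFinD lee_fin.
  have d1 : - be - - (pi / 2) = d by rewrite /be; ring.
  have d2 : pi / 2 - be = d by rewrite /be; ring.
  rewrite d1 in p1; rewrite d2 in p2; move: p1 p2 dM.
  move: (fint _ _ _) (fint _ _ _) (fint _ _ _) (M * d) => x y z w; lra.
rewrite leeD2r// -[be]tanK// fint_atan//; apply: ge0_subset_integral => //.
by move=> u _; rewrite lee_fin divr_ge0// addr_ge0// sqr_ge0.
Qed.

End ArctanSubstitution.

(** * Integrals over a disc centred at the origin *)

Section Disc.
Variable R : realType.
Notation mu := (@lebesgue_measure R).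

Definition disc0 (r : R) : set (R * R) := [set p | p.1 ^+ 2 + p.2 ^+ 2 < r ^+ 2].

Lemma open_disc0 r : open (disc0 r).
Proof.
pose f (p : R * R) := p.1 ^+ 2 + p.2 ^+ 2.
rewrite (_ : disc0 r = f @^-1` [set x | x < r ^+ 2])//.
apply: open_comp; last exact: open_lt.
move=> p _; apply: cvgD.
- by apply: (cvg_comp fst (fun x : R => x ^+ 2)); [exact: cvg_fst|exact:
    exprn_continuous].
- by apply: (cvg_comp snd (fun x : R => x ^+ 2)); [exact: cvg_snd|exact:
    exprn_continuous].
Qed.

Lemma disc0_polar r q th : `|q| < r -> disc0 r (q * cos th, q * sin th).
Proof.
move=> qr; rewrite /disc0/= !exprMn -mulrDr cos2Dsin2 mulr1 -real_normK ?num_real//.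
by rewrite ltr_pXn2r// ?nnegrE// (le_trans _ (ltW qr)).
Qed.

(** Pairs the radii [q] and [- q], so that a half circle is integrated together with its
    antipode. *)
Lemma ge0_integral_fold (J : R -> \bar R) :
  measurable_fun setT J -> (forall q, 0 <= J q)%E ->
  (\int[mu]_q J q = \int[mu]_(q in `[0%R, +oo[) (J q + J (- q)%R))%E.
Proof.
move=> mJ J0.
have mJN : measurable_fun setT (fun q : R => J (- q)%R) by exact: measurableT_comp.
rewrite [RHS]ge0_integralD//; [|exact: (measurable_funTS mJ)|exact:
    (measurable_funTS mJN)].
rewrite (ge0_integration_by_substitution0 mJN)//.
under [X in (_ + X)%E]eq_integral do rewrite opprK.
rewrite -[X in (X + _)%E]integral_itv_obnd_cbnd; last exact: (measurable_funTS mJ).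
rewrite addeC -ge0_integral_setU//.
- congr integral; apply/seteqP; split => x //= _; rewrite !in_itv/= andbT.
  by case: (ltP 0%R x); [right|left].
- exact: (measurable_funTS mJ).
- apply/disj_setPLR => x /=; rewrite !in_itv/= andbT => x0 x1.
  by have := lt_le_trans x1 x0; rewrite ltxx.
Qed.

Lemma continuous_radial (m : R) :
  continuous (fun q : R => 2 * pi * (q * (1 - m * q ^+ 2))).
Proof.
move=> q; apply: cvgM; first exact: cvg_cst.
apply: cvgM; first exact: cvg_id.
apply: cvgB; first exact: cvg_cst.
by apply: cvgM; [exact: cvg_cst|exact: exprn_continuous].
Qed.

(** After division by [pi * r ^+ 2] the term in [m] becomes [m * r ^+ 2 / 2], since [|z|^2] has mean
    [r ^+ 2 / 2] over the disc. This is the origin of the factor 2 in the theorem. *)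
Lemma integral_radial (r m : R) : 0 < r ->
  (\int[mu]_(q in `[0%R, r[) (2 * pi * (q * (1 - m * q ^+ 2)))%:E =
  (pi * (r ^+ 2 - m * r ^+ 4 / 2))%:E)%E.
Proof.
move=> r0; pose F (q : R) := pi * (q ^+ 2 - m * q ^+ 4 / 2).
have dF (q : R) : is_derive q 1 F (2 * pi * (q * (1 - m * q ^+ 2))).
  rewrite /F; apply: is_derive_eq; by rewrite /GRing.scale/=; field.
have cf := @continuous_radial m.
have cF : continuous F by move=> q;
    apply/differentiable_continuous/derivable1_diffP; case: (dF q).
rewrite integral_itv_bndo_bndc; last first.
  by apply/measurable_EFinP/measurable_funTS; exact: continuous_measurable_fun.
rewrite (@continuous_FTC2 _ _ F)//.
- by rewrite -EFinB /F !expr0n/= mulr0 !mul0r subrr mulr0 subr0.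
- exact: continuous_subspaceT.
- split.
  + by move=> x _; case: (dF x).
  + by apply: cvg_at_right_filter; exact: cF.
  + by apply: cvg_at_left_filter; exact: cF.
- by move=> x _; rewrite derive1E; case: (dF x).
Qed.

(** In the application [N] is [|f|^2 exp(- phi)] recentred at [a], [E] is [exp(- phi(a))], [U + i V]
    is [f p], and [NU] is the completed square. *)
Section lower_bound.
Variables (N : R * R -> R) (U V : R -> R -> R) (r m E : R).
Hypotheses (r0 : 0 < r) (mr : m * r ^+ 2 <= 1) (E0 : 0 <= E).
Hypotheses (cN : forall p, disc0 r p -> {for p, continuous N})
  (N0 : forall p, 0 <= N p).
Hypotheses (crU : forall x y, x ^+ 2 + y ^+ 2 < r ^+ 2 -> CR U V x y)
  (U1 : U 0 0 = 1).
Hypothesis NU : forall x y, x ^+ 2 + y ^+ 2 < r ^+ 2 ->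
  E * (2 * U x y - 1 - m * (x ^+ 2 + y ^+ 2)) <= N (x, y).

Let h q th := N (q * cos th, q * sin th) + N (- q * cos th, - q * sin th).

Let Nq_cont q : `|q| < r -> continuous (fun th : R => N (q * cos th, q * sin th)).
Proof.
move=> qr th.
apply: (@cvg_comp _ _ _ (fun th : R => (q * cos th, q * sin th)) N _ (nbhs (q * cos
    th, q * sin th))); last first.
  exact/cN/disc0_polar.
apply: (@cvg_pair _ _ _ _ (nbhs (q * cos th)) (nbhs (q * sin th))).
- by apply: cvgM; [exact: cvg_cst|exact: continuous_cos].
- by apply: cvgM; [exact: cvg_cst|exact: continuous_sin].
Qed.

Let h_cont q : 0 < q < r -> continuous (h q).
Proof.
move=> /andP[q0 qr] th; apply: cvgD; apply: Nq_cont.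
- by rewrite gtr0_norm.
- by rewrite normrN gtr0_norm.
Qed.

Lemma circle_bound q : 0 < q < r ->
  2 * pi * E * (1 - m * q ^+ 2) <= fint (h q) (- (pi / 2)) (pi / 2).
Proof.
move=> /[dup] qI /andP[q0 qr].
(* The even part up to a factor 2; the reflection is spelled so that [CR_affine] applies. *)
pose U2 x y := U x y + U (0 + -1 * x) (0 + -1 * y).
pose V2 x y := V x y + V (0 + -1 * x) (0 + -1 * y).
have cr2 x y : x ^+ 2 + y ^+ 2 < r ^+ 2 -> CR U2 V2 x y.
  move=> xy; apply: CR_add; first exact: crU.
  by apply: CR_affine; apply: crU; rewrite !add0r !mulN1r !sqrrN.
have ev x y : V2 (- x) (- y) = V2 x y.
  by rewrite /V2 !add0r !mulN1r !opprK addrC.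
have mean := CR_mean_value r0 cr2 ev q0 qr.
have pi0 := @pi_gt0 R.
have le2 : - (pi / 2) <= pi / 2 :> R by lra.
have pB : pi / 2 - - (pi / 2) = pi :> R by field.
pose u th := U2 (q * cos th) (q * sin th).
have cu : continuous u.
  move=> th; have qN : q != 0 by rewrite gt_eqF.
  have /(CR_closed_polar qN)/closed_at_cont[] // : CR U2 V2 (q * cos th) (q * sin th).
  by apply: cr2; apply: (@disc0_polar r q th); rewrite gtr0_norm.
(* [w] is the sum of the lower bounds [NU] at the point of angle [th] and at its antipode. *)
pose w th := 2 * E * u th + - (E * (2 + 2 * m * q ^+ 2)).
have cw : continuous w.
  by move=> th; apply: cvgD; [apply: cvgM; [exact: cvg_cst|exact: cu]|exact: cvg_cst].
have iw : fint w (- (pi / 2)) (pi / 2) = 2 * pi * E * (1 - m * q ^+ 2).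
  rewrite /fint RintegralD//; last 2 first.
  - apply: cont_on_integrable => th _.
    by apply: cvgM; [exact: cvg_cst|exact: cu].
  - by apply: cont_on_integrable => th _; exact: cvg_cst.
  rewrite RintegralZl//; last by apply: cont_on_integrable => th _; exact: cu.
  rewrite -/(fint u _ _) -/(fint (fun=> _) _ _) mean fint_cst// pB /U2.
  by rewrite mulr0 addr0 U1; ring.
rewrite -iw; apply: le_Rintegral => //.
- by apply: cont_on_integrable => th _; exact: cw.
- by apply: cont_on_integrable => th _; exact: h_cont.
move=> th _; rewrite /w /h /u /U2 !add0r !mulN1r.
have d1 : (q * cos th) ^+ 2 + (q * sin th) ^+ 2 = q ^+ 2.
  by rewrite !exprMn -mulrDr cos2Dsin2 mulr1.
have d2 : (- (q * cos th)) ^+ 2 + (- (q * sin th)) ^+ 2 = q ^+ 2 by rewrite !sqrrN.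
have qr2 : q ^+ 2 < r ^+ 2 by rewrite ltr_pXn2r// ?nnegrE// ltW.
have := @NU (q * cos th) (q * sin th); rewrite d1 => /(_ qr2).
have := @NU (- (q * cos th)) (- (q * sin th)); rewrite d2 => /(_ qr2).
rewrite -!mulNr.
move: (N _) (N _) (U _ _) (U _ _) => n1 n2 u1 u2 a1 a2.
apply: le_trans (lerD a2 a1); rewrite le_eqVlt; apply/orP; left; apply/eqP; ring.
Qed.

Local Open Scope ereal_scope.

Lemma disc0_lower_bound :
  (E * (pi * (r ^+ 2 - m * r ^+ 4 / 2)))%:E <= \int[@leb2 R]_(p in disc0 r) (N p)%:E.
Proof.
have mD : measurable (disc0 r) by apply: open2_measurable; exact: open_disc0.
rewrite integral_mkcond; pose k : R * R -> \bar R := (fun p => (N p)%:E) \_ (disc0 r).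
rewrite -/k.
have mk : measurable_fun setT k.
  have mN : measurable_fun (disc0 r) N.
    by apply: open2_continuous_measurable => //; exact: open_disc0.
  have mN2 : measurable_fun (disc0 r) (EFin \o N) by apply/measurable_EFinP.
  exact: ((measurable_restrictT _ mD).1 mN2).
have k0 p : 0 <= k p by apply: erestrict_ge0 => q _; rewrite lee_fin.
rewrite ge0_integral_polar//.
pose J q := \int[mu]_u polar_density k (q, u).
have J0 q : 0 <= J q by apply: integral_ge0 => u _; exact: polar_density_ge0.
have mJ : measurable_fun setT J.
  apply: (@measurable_fun_fubini_tonelli_F _ _ (measurableTypeR R) (measurableTypeR
      R) R mu).
    exact: measurable_polar_density.
  by move=> p; exact: polar_density_ge0.
have mJN : measurable_fun setT (fun q : R => J (- q)%R) by exact: measurableT_comp.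
rewrite -[leRHS]/(\int[mu]_q J q).
have -> : \int[mu]_q J q = \int[mu]_(q in `[0%R, +oo[) (J q + J (- q)%R).
  exact: ge0_integral_fold.
apply: (@le_trans _ _ (\int[mu]_(q in `[0%R, r[) (J q + J (- q)%R))); last first.
  apply: ge0_subset_integral => //.
  - by apply: emeasurable_funD; [exact: (measurable_funTS mJ)|exact:
      (measurable_funTS mJN)].
  - by move=> q _; rewrite adde_ge0.
  - by apply: subset_itv => //; rewrite bnd_simp.
have mrad : measurable_fun `[0%R, r[ (fun q : R => (2 * pi * (q * (1 - m * q ^+
    2)))%:E).
  apply/measurable_EFinP/measurable_funTS; apply: continuous_measurable_fun.
  exact: continuous_radial.
(* Here [m * r ^+ 2 <= 1] enters: it makes the radial minorant nonnegative, so that integrals of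
   nonnegative functions can be compared. *)
have rad0 (q : R) : [set` `[0%R, r[] q -> 0 <= (2 * pi * (q * (1 - m * q ^+ 2)))%:E.
  rewrite /= in_itv/= => /andP[q0 qr]; rewrite lee_fin !mulr_ge0// ?pi_ge0// subr_ge0.
  have [m0|m0] := leP 0%R m; last first.
    by rewrite (le_trans _ ler01)// nmulr_rle0// sqr_ge0.
  apply: le_trans mr; rewrite ler_wpM2l// ler_pXn2r// ?nnegrE// ltW//.
rewrite EFinM -(integral_radial m r0) -ge0_integralZl//.
apply: ge0_le_integral => //.
- by move=> q Dq; rewrite mule_ge0 ?lee_fin//; exact: rad0.
- by apply: measurable_funeM; exact: mrad.
- by apply: emeasurable_funD; [exact: (measurable_funTS mJ)|exact:
    (measurable_funTS mJN)].
move=> q; rewrite /= in_itv/= => /andP[]; rewrite le_eqVlt => /predU1P[<- _|q0 qr].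
  by rewrite mul0r !mulr0 mule0 adde_ge0.
have qI : (0 < q < r)%R by rewrite q0.
have kE s u : (`|s| = q)%R -> polar_density k (s, u) =
    (q * (N (s * cos (atan u), s * sin (atan u)) / (1 + u ^+ 2)))%:E.
  move=> sq; rewrite /polar_density/= -mulrA -sin_atan -cos_atan sq /k patchE ifT;
      last first.
    by apply/mem_set/disc0_polar; rewrite sq.
  by rewrite -EFinM; congr EFin; ring.
have -> : J q + J (- q)%R = q%:E * \int[mu]_u (h q (atan u) / (1 + u ^+ 2))%:E.
  rewrite /J -ge0_integralD//; last 4 first.
  - by move=> u _; exact: polar_density_ge0.
  - by apply: measurable_fun_pair2; exact: measurable_polar_density.
  - by move=> u _; exact: polar_density_ge0.
  - by apply: measurable_fun_pair2; exact: measurable_polar_density.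
  rewrite -ge0_integralZl//.
  - apply: eq_integral => u _; rewrite !kE ?normrN ?gtr0_norm// -EFinD -EFinM.
    by congr EFin; rewrite /h; ring.
  - apply/measurable_EFinP; apply: continuous_measurable_fun => x; apply: cvgM.
      by apply: (continuous_comp (@continuous_atan R x)); exact: h_cont.
    apply: cvgV; first by rewrite gt_eqF// ltr_pwDl// sqr_ge0.
    by apply: cvgD; [exact: cvg_cst|exact: exprn_continuous].
  - by move=> u _; rewrite lee_fin divr_ge0// ?addr_ge0// sqr_ge0.
  - by rewrite lee_fin ltW.
have h0 th : (0 <= h q th)%R by rewrite addr_ge0.
apply: le_trans (lee_wpmul2l _ (fint_le_atan (h_cont qI) h0)); last by rewrite
    lee_fin ltW.
rewrite -!EFinM lee_fin; apply: le_trans (ler_wpM2l (ltW q0) (circle_bound qI)).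
by rewrite le_eqVlt; apply/orP; left; apply/eqP; ring.
Qed.

End lower_bound.
End Disc.

(** * Complex differentiability *)

Section Complex.
Local Open Scope complex_scope.
Variable R : realType.

Lemma le_cnorm_dist (z : R[i]) (c : R) : `|z| <= c%:C -> `|complex.Re z| <= c /\
    `|complex.Im z| <= c.
Proof.
rewrite normc_def lecR => zc; split; apply: le_trans zc.
- by rewrite -sqrtr_sqr ler_wsqrtr// lerDl sqr_ge0.
- by rewrite -sqrtr_sqr ler_wsqrtr// lerDr sqr_ge0.
Qed.

Lemma cnorm_le_dist (z : R[i]) : `|z| <= (`|complex.Re z| + `|complex.Im z|)%:C.
Proof.
rewrite normc_def lecR -[leRHS]ger0_norm ?addr_ge0// -[leRHS]sqrtr_sqr ler_wsqrtr//.
rewrite sqrrD !real_normK ?num_real// addrAC lerDl mulrn_wge0// mulr_ge0//.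
Qed.

Lemma derivable_small (f : R[i] -> R[i]) (z : R[i]) : derivable f z 1 ->
  exists D : R[i], forall e : R, 0 < e -> exists2 d : R, 0 < d &
    forall w, `|w - z| < d%:C -> `|f w - f z - D * (w - z)| <= e%:C * `|w - z|.
Proof.
move=> /cvg_ex[/= D /cvgrPdist_lt fD]; exists D => e e0.
have e0C : 0 < e%:C by rewrite ltcR.
have := fD _ e0C => /nbhs_ballP[d /= d0 H].
(* The radius [d] is an element of [R[i]], but [0 < d] forces it to be real. *)
have dE : d = (complex.Re d)%:C by rewrite RRe_real// ger0_real// ltW.
exists (complex.Re d); first by rewrite -ltcR -dE.
move=> w; rewrite -dE => wd.
have [->|wz] := eqVneq w z; first by rewrite !subrr mulr0 subr0 normr0 mulr0.
have wz0 : w - z != 0 by rewrite subr_eq0.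
have := H (w - z); rewrite /ball/= sub0r normrN => /(_ wd wz0).
have -> : (w - z) *: (1 : R[i]) + z = w by rewrite [_ *: 1]mulr1 subrK.
move=> /ltW /(ler_wpM2r (normr_ge0 (w - z))); rewrite -normrM.
have -> : (D - (w - z)^-1 *: (f w - f z)) * (w - z) = - (f w - f z - D * (w - z)).
  rewrite mulrBl opprB; congr (_ - _).
  by rewrite [_ *: _]/((w - z)^-1 * _) mulrAC mulVf// mul1r.
by rewrite normrN.
Qed.

Lemma derivable_CR (f : R[i] -> R[i]) x y : derivable f (x +i* y) 1 ->
  CR (fun x y => complex.Re (f (x +i* y))) (fun x y => complex.Im (f (x +i* y))) x y.
Proof.
move=> /derivable_small[[A B] H]; exists A, B.
have est e : 0 < e -> exists2 d : R, 0 < d &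
    forall x' y', `|x' - x| <= d -> `|y' - y| <= d ->
    `|f (x' +i* y') - f (x +i* y) - (A +i* B) * ((x' - x) +i* (y' - y))| <= (e *
        (`|x' - x| + `|y' - y|))%:C.
  (* Two coordinates within [d / 3] put the modulus at most [2 * d / 3], strictly below [d]. *)
  move=> e0; have [d d0 {}H] := H _ e0; exists (d / 3); first by rewrite divr_gt0.
  move=> x' y' xd yd.
  have le1 := cnorm_le_dist ((x' - x) +i* (y' - y)).
  have := H (x' +i* y').
  have -> : x' +i* y' - (x +i* y) = (x' - x) +i* (y' - y) by [].
  move=> /(_ _)/le_trans; apply.
    by apply: le_lt_trans le1 _; rewrite ltcR /=; lra.
  by rewrite rmorphM/= ler_pM2l// ltcR.
split=> e e0; have [d d0 {}H] := est e e0; exists d => // x' y' xd yd.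
- have [+ _] := le_cnorm_dist (H x' y' xd yd).
  case: (f _) => u v; case: (f _) => u' v' /=; apply: le_trans.
  by rewrite le_eqVlt; apply/orP; left; apply/eqP; congr `|_|; ring.
- have [_] := le_cnorm_dist (H x' y' xd yd).
  case: (f _) => u v; case: (f _) => u' v' /=; apply: le_trans.
  by rewrite le_eqVlt; apply/orP; left; apply/eqP; congr `|_|; ring.
Qed.

End Complex.

(** * Second order expansions *)

Section Taylor.
Variable R : realType.
Implicit Types (x y s t e d : R).

Lemma mvt_bound (G dG : R -> R) (M t : R) :
  (forall u : R, `|u| <= `|t| -> is_derive u 1 G (dG u) /\ `|dG u| <= M) ->
  `|G t - G 0| <= M * `|t|.
Proof.
move=> H.
have cG (u : R) : `|u| <= `|t| -> {for u, continuous G}.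
  by move=> /H[[? _] _]; apply/differentiable_continuous/derivable1_diffP.
have M0 : 0 <= M by have [|_ /(le_trans _)->] := H 0; rewrite ?normr0.
have [t0|/ltW t0] := leP 0 t.
- have [c cI ->] : exists2 c, c \in `[0, t] & G t - G 0 = dG c * (t - 0).
    apply: MVT_segment => //.
      move=> u; rewrite in_itv/= => /andP[u0 ut].
      have /H[] // : `|u| <= `|t| by rewrite (ger0_norm (ltW u0)) (ger0_norm t0) ltW.
    apply: cont_on_within => u /andP[u0 ut]; apply: cG.
    by rewrite !ger0_norm.
  rewrite subr0 normrM ler_wpM2r//; have [] // := H c.
  by move: cI; rewrite in_itv/= => /andP[c0 ct]; rewrite !ger0_norm.
- have [c cI E] : exists2 c, c \in `[t, 0] & G 0 - G t = dG c * (0 - t).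
    apply: MVT_segment => //.
      move=> u; rewrite in_itv/= => /andP[u0 ut].
      have /H[] // : `|u| <= `|t| by rewrite (ler0_norm (ltW ut)) (ler0_norm t0)
          lerN2 ltW.
    apply: cont_on_within => u /andP[u0 ut]; apply: cG.
    by rewrite !ler0_norm// lerN2.
  rewrite distrC E sub0r normrM normrN ler_wpM2r//; have [] // := H c.
  by move: cI; rewrite in_itv/= => /andP[c0 ct]; rewrite !ler0_norm// lerN2.
Qed.

Lemma derive_small (g : R -> R) x D e : is_derive x 1 g D -> 0 < e ->
  exists2 d, 0 < d & forall s, `|s| <= d -> `|g (x + s) - g x - D * s| <= e * `|s|.
Proof.
move=> /(is_derive_cdiff1 0) H e0; have [d d0 {}H] := H e e0; exists d => // s sd.
by have := H (x + s) 0; rewrite (addrC x s) addrK subrr mulr0 normr0 addr0 subr0;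
    apply=> //; exact: ltW.
Qed.

Lemma is_derive_quad (g : R -> R) (x u D p q : R) : is_derive (x + u) 1 g D ->
  is_derive u 1 (fun u => g (x + u) - p * u - q * (u ^+ 2 / 2)) (D - p - q * u).
Proof.
move=> dg.
have d1 : is_derive u 1 (fun u => g (x + u)) D.
  have dx : is_derive u 1 (fun u => x + u) 1.
    by have := is_deriveD (is_derive_cst x u 1) (is_derive_id u 1); rewrite add0r.
  by have := is_derive1_comp dg dx; rewrite mulr1.
apply: is_derive_eq; rewrite /GRing.scale/=.
by field.
Qed.

(** The derivative of the second order remainder is the first order remainder, so the mean value
    inequality yields one bound from the other. *)
Lemma expR_second_order e : 0 < e -> exists2 d, 0 < d &
  forall y, `|y| <= d -> `|expR y - 1 - y| <= e * `|y| /\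
    `|expR y - 1 - y - y ^+ 2 / 2| <= e * y ^+ 2.
Proof.
move=> e0; have [d d0 H] := derive_small (is_derive_expR 0) e0.
have H1 y : `|y| <= d -> `|expR y - 1 - y| <= e * `|y|.
  by move=> /H; rewrite add0r expR0 mul1r.
exists d => // y yd; split; first exact: H1.
have := @mvt_bound (fun u => expR (0 + u) - 1 * u - 1 * (u ^+ 2 / 2)) (fun u =>
    expR u - 1 - 1 * u) (e * `|y|) y.
rewrite !add0r expR0 expr0n/= mul0r !mulr0 !subr0 !mul1r.
have -> : expR y - 1 - y - y ^+ 2 / 2 = expR y - y - y ^+ 2 / 2 - 1 by ring.
rewrite -mulrA -expr2 real_normK ?num_real//; apply => u uy; split.
  by apply: is_derive_quad; rewrite add0r; exact: is_derive_expR.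
rewrite mul1r; apply: le_trans (H1 u (le_trans uy yd)) _.
by rewrite ler_pM2l.
Qed.

Section taylor_core.
Variables (F Fx Fy Fyy : R -> R -> R) (a b p q A B C r e' s t : R).
Hypotheses (D1 : forall u : R, `|u| <= r -> is_derive (a + u) 1 (F ^~ b) (Fx (a + u) b))
  (D2 : forall s u : R, `|s| <= r -> `|u| <= r -> is_derive (b + u) 1 (F (a + s))
      (Fy (a + s) (b + u)))
  (D3 : forall s u : R, `|s| <= r -> `|u| <= r -> is_derive (b + u) 1 (Fy (a + s))
      (Fyy (a + s) (b + u)))
  (e'0 : 0 < e') (s0 : `|s| <= r) (t0 : `|t| <= r)
  (H1 : forall u, `|u| <= `|s| -> `|Fx (a + u) b - p - A * u| <= e' * `|u|)
  (H2 : `|Fy (a + s) b - q - B * s| <= e' * `|s|)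
  (H3 : forall u, `|u| <= `|t| -> `|Fyy (a + s) (b + u) - C| <= e').

(** The increment is taken along [(a, b)], [(a + s, b)], [(a + s, b + t)]. The horizontal leg gives
    the terms in [s] alone; on the vertical leg the initial slope [Fy (a + s) b] is [q + B * s] up
    to a small error, which produces the cross term from a single mixed derivative. *)
Lemma taylor_core :
   `|F (a + s) (b + t) - F a b - p * s - q * t
     - A * (s ^+ 2 / 2) - B * (s * t) - C * (t ^+ 2 / 2)|
   <= 2 * e' * (s ^+ 2 + t ^+ 2).
Proof.
have S1 : `|F (a + s) b - F a b - p * s - A * (s ^+ 2 / 2)| <= e' * s ^+ 2.
  have := @mvt_bound (fun u => F (a + u) b - p * u - A * (u ^+ 2 / 2))
    (fun u => Fx (a + u) b - p - A * u) (e' * `|s|) s.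
  rewrite addr0 expr0n/= mul0r !mulr0 !subr0 -mulrA -expr2 real_normK ?num_real//.
  rewrite (_ : _ - _ - _ - F a b = F (a + s) b - F a b - p * s - A * (s ^+ 2 / 2));
      last by ring.
  apply => u us; split.
    by apply: (@is_derive_quad (fun x => F x b)); apply: D1; exact: le_trans us s0.
  apply: le_trans (H1 us) _.
  by rewrite ler_pM2l.
have S2 : `|F (a + s) (b + t) - F (a + s) b - (q + B * s) * t - C * (t ^+ 2 / 2)|
    <= e' * (`|s| + `|t|) * `|t|.
  have := @mvt_bound (fun u => F (a + s) (b + u) - (q + B * s) * u - C * (u ^+ 2 / 2))
    (fun u => Fy (a + s) (b + u) - (q + B * s) - C * u) (e' * (`|s| + `|t|)) t.
  rewrite addr0 expr0n/= mul0r !mulr0 !subr0.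
  rewrite (_ : _ - _ - _ - F (a + s) b = F (a + s) (b + t) - F (a + s) b - (q + B *
      s) * t - C * (t ^+ 2 / 2)); last by ring.
  apply => u ut; split.
    by apply: (@is_derive_quad (fun y => F (a + s) y)); apply: D2 => //; exact:
        le_trans ut t0.
  have := @mvt_bound (fun v => Fy (a + s) (b + v) - C * v - 0 * (v ^+ 2 / 2))
    (fun v => Fyy (a + s) (b + v) - C - 0 * v) e' u.
  rewrite addr0 expr0n/= !mul0r !mulr0 !subr0.
  move=> H3u; have {}H3u : `|Fy (a + s) (b + u) - C * u - Fy (a + s) b| <= e' * `|u|.
    apply: H3u => v vu; have vt := le_trans vu ut; split.
      by apply: (@is_derive_quad (fun y => Fy (a + s) y)); apply: D3 => //; exact:
          le_trans vt t0.
    by rewrite mul0r subr0; exact: H3.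
  rewrite (_ : _ - _ - _ = (Fy (a + s) (b + u) - C * u - Fy (a + s) b) +
    (Fy (a + s) b - q - B * s)); last by ring.
  apply: le_trans (ler_normD _ _) _; rewrite [leRHS]mulrDr addrC.
  apply: lerD; first exact: H2.
  by apply: le_trans H3u _; rewrite ler_pM2l.
rewrite (_ : _ - _ - _ - _ - _ - _ - _ =
  (F (a + s) b - F a b - p * s - A * (s ^+ 2 / 2)) +
  (F (a + s) (b + t) - F (a + s) b - (q + B * s) * t - C * (t ^+ 2 / 2))); last by ring.
apply: le_trans (ler_normD _ _) _; apply: le_trans (lerD S1 S2) _.
rewrite -(real_normK (num_real s)) -(real_normK (num_real t)).
have : 0 <= e' * (`|s| - `|t|) ^+ 2 by rewrite mulr_ge0 ?sqr_ge0// ltW.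
have : 0 <= e' * `|s| ^+ 2 by rewrite mulr_ge0 ?sqr_ge0// ltW.
have : 0 <= e' * `|t| ^+ 2 by rewrite mulr_ge0 ?sqr_ge0// ltW.
move: `|s| `|t| => S T; nra.
Qed.
End taylor_core.

Lemma taylor2 (F : R -> R -> R) (O : set (R * R)) (a b r0 : R) :
  0 < r0 -> (forall s t, `|s| <= r0 -> `|t| <= r0 -> O (a + s, b + t)) ->
  Ck 2 F O -> forall e, 0 < e -> exists2 d, 0 < d & forall s t, `|s| <= d -> `|t|
      <= d ->
   `|F (a + s) (b + t) - F a b - dx F a b * s - dy F a b * t
     - dx (dx F) a b * (s ^+ 2 / 2) - dx (dy F) a b * (s * t) - dy (dy F) a b * (t
         ^+ 2 / 2)|
   <= e * (s ^+ 2 + t ^+ 2).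
Proof.
move=> r00 HO [dF [cF [[dFx [cFx _]] [dFy [cFy [_ cFyy]]]]]] e e0.
have Oab : O (a, b) by have := HO 0 0; rewrite !addr0 normr0 => /(_ (ltW r00) (ltW
    r00)).
have isd (g : R -> R) x : derivable g x 1 -> is_derive x 1 g (derive1 g x).
  by move=> dg; rewrite derive1E; exact: derivableP.
pose e' := e / 2; have e'0 : 0 < e' by rewrite divr_gt0.
have [d1 d10 H1] := derive_small (isd _ _ (dFx _ Oab).1) e'0.
have [d2 d20 H2] := derive_small (isd _ _ (dFy _ Oab).1) e'0.
have [d3 d30 H3] : exists2 d, 0 < d & forall s t, `|s| <= d -> `|t| <= d ->
   `|dy (dy F) (a + s) (b + t) - dy (dy F) a b| <= e'.
  have := cFyy _ Oab => /cvgrPdistC_le/(_ _ e'0)/nbhs_ballP[d /= d0 H].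
  exists (d / 2); first by rewrite divr_gt0.
  move=> s t sd td; apply: (H (a + s, b + t)).
  by split; rewrite /ball/= opprD addrA subrr sub0r normrN; lra.
pose d := Num.min r0 (Num.min d1 (Num.min d2 d3)).
exists d; first by rewrite !lt_min r00 d10 d20.
move=> s t; rewrite !le_min => /and4P[s0 s1 s2 s3] /and4P[t0 t1 t2 t3].
have -> : e = 2 * e' by rewrite /e'; field.
apply: (@taylor_core F (dx F) (dy F) (dy (dy F)) a b (dx F a b) (dy F a b)
  (dx (dx F) a b) (dx (dy F) a b) (dy (dy F) a b) r0 e' s t).
- move=> u ur; apply: isd; apply: (dF (a + u, b) _).1.
  by have := HO u 0; rewrite addr0 normr0; apply => //; exact: ltW.
- by move=> s' u sr ur; apply: isd; apply: (dF (a + s', b + u) _).2; exact: HO.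
- by move=> s' u sr ur; apply: isd; apply: (dFy (a + s', b + u) _).2; exact: HO.
- exact: e'0.
- exact: s0.
- exact: t0.
- by move=> u us; apply: H1; exact: le_trans us s1.
- exact: H2.
- by move=> u ut; apply: H3 => //; exact: le_trans ut t3.
Qed.

End Taylor.

(** * The weight *)

Section Weight.
Variable R : realType.
Implicit Types (s t e d : R).

(* Real and imaginary parts of (c1 + i c2) z + (b1 + i b2) z^2 at z = s + i t. *)
Definition qre (c1 c2 b1 b2 s t : R) := c1 * s - c2 * t + b1 * (s ^+ 2 - t ^+ 2) -
    b2 * (2 * (s * t)).
Definition qim (c1 c2 b1 b2 s t : R) := c1 * t + c2 * s + b1 * (2 * (s * t)) + b2 *
    (s ^+ 2 - t ^+ 2).

(* Real and imaginary parts of 1 - h/2 + h^2/8, the quadratic truncation of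
   exp(-h/2), where h = X + i Y. *)
Definition pre (X Y : R) := 1 - X / 2 + (X ^+ 2 - Y ^+ 2) / 8.
Definition pim (X Y : R) := - (Y / 2) + X * Y / 4.

(** The first three terms are the second order expansion of [expR (- X)]; the last one is cubic. *)
Lemma pre_pim_sq X Y : pre X Y ^+ 2 + pim X Y ^+ 2 =
  1 - X + X ^+ 2 / 2 + (X ^+ 2 + Y ^+ 2) * (- (X / 8) + (X ^+ 2 + Y ^+ 2) / 64).
Proof. by rewrite /pre /pim; field. Qed.

Lemma quad_bound (c1 c2 b1 b2 s t : R) : `|s| <= 1 -> `|t| <= 1 ->
  `|c1 * s + c2 * t + b1 * (s ^+ 2 - t ^+ 2) + b2 * (2 * (s * t))| <=
  (`|c1| + `|c2| + 2 * `|b1| + 2 * `|b2| + 1) * (`|s| + `|t|).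
Proof.
move=> s1 t1.
have b : `|s ^+ 2 - t ^+ 2| <= `|s| + `|t|.
  apply: le_trans (ler_normB _ _) _; rewrite !normrX; apply: lerD.
  - by rewrite expr2 ler_piMr.
  - by rewrite expr2 ler_piMr.
have b' : `|2 * (s * t)| <= 2 * (`|s| + `|t|).
  rewrite !normrM (ger0_norm (ler0n _ _)) ler_pM2l// (le_trans (_ : _ <= `|s|))//;
      last by rewrite lerDl.
  by rewrite ler_piMr.
apply: le_trans (ler_normD _ _) _; apply: (@le_trans _ _ (`|c1| * `|s| + `|c2| *
    `|t| + `|b1| * (`|s| + `|t|) + `|b2| * (2 * (`|s| + `|t|)))).
  apply: lerD; last by rewrite normrM ler_wpM2l.
  apply: le_trans (ler_normD _ _) _; apply: lerD; last by rewrite normrM ler_wpM2l.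
  by apply: le_trans (ler_normD _ _) _; rewrite !normrM.
have := normr_ge0 c1; have := normr_ge0 c2; have := normr_ge0 b1; have := normr_ge0 b2.
have := normr_ge0 s; have := normr_ge0 t.
move: `|c1| `|c2| `|b1| `|b2| `|s| `|t| => C1 C2 B1 B2 S T T0 S0 B20 B10 C20 C10.
rewrite -subr_ge0 (_ : _ - _ = C1 * T + C2 * S + B1 * (S + T) + S + T); last by ring.
by rewrite !addr_ge0// mulr_ge0// addr_ge0.
Qed.

(** The exponent on the left already carries one [e], for the Taylor error of the weight. A second
    one pays for [|p|^2 <= expR (- X + e * z)], a third for [expR ((lam + 2 * e) * z) <= 1 + (lam +
    3 * e) * z]. *)
Lemma weight_bound (c1 c2 b1 b2 lam e : R) : 0 < e -> exists2 d, 0 < d &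
  forall s t, `|s| <= d -> `|t| <= d ->
    let X := qre c1 c2 b1 b2 s t in let Y := qim c1 c2 b1 b2 s t in
    let z := s ^+ 2 + t ^+ 2 in
    (pre X Y ^+ 2 + pim X Y ^+ 2) * expR (X + (lam + e) * z) <= 1 + (lam + 3 * e) * z.
Proof.
move=> e0.
pose K := `|c1| + `|c2| + 2 * `|b1| + 2 * `|b2| + 1.
have K0 : 0 < K by rewrite ltr_wpDl// !addr_ge0// mulr_ge0.
pose M := `|lam + 2 * e| + 1; have M0 : 0 < M by rewrite ltr_wpDl.
have K20 : 0 < K ^+ 2 by rewrite exprn_gt0.
have e20 : 0 < e / (16 * K ^+ 2) by rewrite divr_gt0// mulr_gt0.
have [d2 d20 H2] := expR_second_order e20.
have e30 : 0 < e / M by rewrite divr_gt0.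
have [d3 d30 H3] := expR_second_order e30.
(* [eta] will bound [|X|] and [|Y|]: [1 / 2] keeps [expR (- X)] above [1 / 2], the second bound
   makes the cubic term at most [e * z / 8], and [d2] validates the expansion of [expR (- X)]. *)
pose eta := Num.min (1 / 2) (Num.min (e / (8 * K ^+ 2)) d2).
have eta0 : 0 < eta by rewrite !lt_min d20 !divr_gt0// mulr_gt0.
have eta1 : eta <= 1 / 2 by rewrite ge_min lexx.
have eta2 : eta <= e / (8 * K ^+ 2) by rewrite !ge_min lexx orbT.
have eta3 : eta <= d2 by rewrite !ge_min lexx !orbT.
exists (Num.min 1 (Num.min (eta / (2 * K)) (d3 / (2 * M)))).
  by rewrite !lt_min ltr01 !divr_gt0// mulr_gt0.
move=> s t ss tt; lazy zeta.
set X := qre _ _ _ _ _ _; set Y := qim _ _ _ _ _ _; set z := s ^+ 2 + t ^+ 2; move: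
    ss tt.
rewrite !le_min => /and3P[s1 s2 s3] /and3P[t1 t2 t3].
have n1 : K * (`|s| + `|t|) <= eta.
  move: s2 t2; rewrite !ler_pdivlMr ?mulr_gt0//; lra.
have n2 : (`|s| + `|t|) ^+ 2 <= 2 * z.
  rewrite /z -(real_normK (num_real s)) -(real_normK (num_real t)).
  have := sqr_ge0 (`|s| - `|t|); move: `|s| `|t| => S T; nra.
have z0 : 0 <= z by rewrite addr_ge0// sqr_ge0.
have XK : `|X| <= K * (`|s| + `|t|).
  have := @quad_bound c1 (- c2) b1 (- b2) s t s1 t1.
  by rewrite !normrN /X /qre !mulNr.
have YK : `|Y| <= K * (`|s| + `|t|).
  have -> : Y = c2 * s + c1 * t + b2 * (s ^+ 2 - t ^+ 2) + b1 * (2 * (s * t)).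
    by rewrite /Y /qim; ring.
  have -> : K = `|c2| + `|c1| + 2 * `|b2| + 2 * `|b1| + 1 by rewrite /K; ring.
  exact: quad_bound.
have sqK (W : R) : `|W| <= K * (`|s| + `|t|) -> W ^+ 2 <= 2 * K ^+ 2 * z.
  move=> h; rewrite -(real_normK (num_real W)).
  apply: (@le_trans _ _ ((K * (`|s| + `|t|)) ^+ 2)).
    by rewrite lerXn2r ?nnegrE// mulr_ge0 ?addr_ge0// ltW.
  have -> : 2 * K ^+ 2 * z = K ^+ 2 * (2 * z) by ring.
  by rewrite exprMn; apply: ler_wpM2l => //; exact: ltW.
have X2 := sqK _ XK; have Y2 := sqK _ YK.
have Xe := le_trans XK n1; have Ye := le_trans YK n1.
have p_le : pre X Y ^+ 2 + pim X Y ^+ 2 <= expR (- X + e * z).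
  rewrite pre_pim_sq expRD.
  have ez0 : 0 <= e * z by rewrite mulr_ge0// ltW.
  have E1 := @expR_ge1Dx R (e * z).
  have XN : `|- X| <= eta by rewrite normrN.
  have [_] := H2 (- X) (le_trans XN eta3); rewrite sqrrN ler_norml => /andP[E2 _].
  have E3 : e / (16 * K ^+ 2) * X ^+ 2 <= e * z / 8.
    apply: (@le_trans _ _ (e / (16 * K ^+ 2) * (2 * K ^+ 2 * z))); first by rewrite
        ler_pM2l.
    by rewrite le_eqVlt; apply/orP; left; apply/eqP; field; rewrite gt_eqF.
  pose n := X ^+ 2 + Y ^+ 2; rewrite -/n.
  have n0 : 0 <= n by rewrite addr_ge0// sqr_ge0.
  have sqe (W : R) : `|W| <= eta -> W ^+ 2 <= eta / 2.
    move=> h; rewrite -(real_normK (num_real W)) expr2.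
    apply: (@le_trans _ _ (eta * (1 / 2))); last by rewrite mul1r.
    by apply: ler_pM => //; exact: le_trans eta1.
  have ne : n <= eta by rewrite [eta]splitr lerD// sqe.
  have k4 : - (X / 8) + n / 64 <= eta / 4.
    by move: Xe; rewrite ler_norml => /andP[]; lra.
  have nk : n * (- (X / 8) + n / 64) <= e * z / 8.
    apply: (@le_trans _ _ (n * (eta / 4))); first by rewrite ler_wpM2l.
    apply: (@le_trans _ _ ((4 * K ^+ 2 * z) * (e / (8 * K ^+ 2) / 4))).
      apply: ler_pM => //; first by rewrite divr_ge0// ltW.
        by rewrite /n; lra.
      by rewrite ler_pM2r.
    by rewrite le_eqVlt; apply/orP; left; apply/eqP; field; rewrite gt_eqF.
  have X12 : 1 / 2 <= expR (- X).
    apply: le_trans (expR_ge1Dx _).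
    by move: Xe; rewrite ler_norml => /andP[]; lra.
  (* The factor [expR (e * z)] gains [e * z / 2], while the cubic term and the remainder of
     [expR (- X)] spend [e * z / 8] each. *)
  have E4 : expR (- X) + e * z / 2 <= expR (- X) * expR (e * z).
    apply: (@le_trans _ _ (expR (- X) * (1 + e * z))); last by rewrite ler_pM2l
        ?expR_gt0.
    by move: (expR (- X)) (e * z) X12 ez0 => u v u12 v0; nra.
  apply: le_trans E4; move: E2 E3 nk.
  move: (n * _) (e / (16 * K ^+ 2) * X ^+ 2) (expR _) (e * z) (X ^+ 2 / 2) ez0 => u
      v w y q; lra.
apply: (@le_trans _ _ (expR ((lam + 2 * e) * z))).
  have -> : (lam + 2 * e) * z = (- X + e * z) + (X + (lam + e) * z) by ring.
  by rewrite [leRHS]expRD; apply: ler_wpM2r => //; exact: expR_ge0.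
have lz : `|(lam + 2 * e) * z| <= M * z.
  by rewrite normrM (ger0_norm z0) ler_wpM2r// lerDl.
have zd : M * z <= d3.
  have h (w : R) : `|w| <= 1 -> `|w| <= d3 / (2 * M) -> w ^+ 2 <= d3 / (2 * M).
    move=> w1 w2; rewrite -(real_normK (num_real w)) expr2; apply: le_trans w2.
    by rewrite ler_piMr.
  have := lerD (h s s1 s3) (h t t1 t3).
  rewrite -/z => /(ler_wpM2l (ltW M0))/le_trans; apply.
  by rewrite le_eqVlt; apply/orP; left; apply/eqP; field; rewrite gt_eqF.
have [+ _] := H3 _ (le_trans lz zd).
have : e / M * `|(lam + 2 * e) * z| <= e * z.
  apply: (@le_trans _ _ (e / M * (M * z))); first by rewrite ler_pM2l.
  by rewrite mulrA divfK ?gt_eqF.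
move: (`|(lam + 2 * e) * z|) => w hw.
move=> /(le_trans (ler_norm _)); lra.
Qed.

(** Expand [w |f - conj(p) / w|^2 >= 0], where [f = f1 + i f2] and [p = p1 + i p2]. *)
Lemma complex_am_gm (f1 f2 p1 p2 w T : R) : 0 < w -> (p1 ^+ 2 + p2 ^+ 2) / w <= T ->
  2 * (f1 * p1 - f2 * p2) - T <= (f1 ^+ 2 + f2 ^+ 2) * w.
Proof.
move=> w0 pT.
have : 0 <= w * ((f1 - p1 / w) ^+ 2 + (f2 + p2 / w) ^+ 2).
  by apply: mulr_ge0; [exact: ltW|rewrite addr_ge0 ?sqr_ge0].
have -> : w * ((f1 - p1 / w) ^+ 2 + (f2 + p2 / w) ^+ 2) =
  (f1 ^+ 2 + f2 ^+ 2) * w - 2 * (f1 * p1 - f2 * p2) + (p1 ^+ 2 + p2 ^+ 2) / w.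
  by field; rewrite gt_eqF.
lra.
Qed.

End Weight.

(** * The L2-extension index *)

Section L2index.
Local Open Scope complex_scope.
Variable R : realType.
Notation mu := (@lebesgue_measure R).

Lemma continuous_shift2 (Q : R * R -> R) (a b : R) p :
  {for (a + p.1, b + p.2), continuous Q} ->
  {for p, continuous (fun p : R * R => Q (a + p.1, b + p.2))}.
Proof.
move=> cQ; apply: (@cvg_comp _ _ _ (fun p : R * R => (a + p.1, b + p.2)) Q _ (nbhs
    (a + p.1, b + p.2))); last exact: cQ.
apply: (@cvg_pair _ _ _ _ (nbhs (a + p.1)) (nbhs (b + p.2))).
- by apply: cvgD; [exact: cvg_cst|exact: cvg_fst].
- by apply: cvgD; [exact: cvg_cst|exact: cvg_snd].
Qed.

Lemma cdiff_continuous (Q : R -> R -> R) s t A B : cdiff Q s t A B ->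
  {for (s, t), continuous (fun p : R * R => Q p.1 p.2)}.
Proof.
move=> /(_ 1 ltr01)[d d0 H]; apply/cvgrPdistC_le => e e0 /=.
pose k := `|A| + `|B| + 2; have k0 : 0 < k by rewrite ltr_wpDl ?addr_ge0.
pose d' := Num.min d (e / k); have d'0 : 0 < d' by rewrite lt_min d0 divr_gt0.
exists ([set s' | `|s' - s| <= d'], [set t' | `|t' - t| <= d']).
  by split; exact: near_dist_le.
move=> [s' t'] [/= s1 t1].
have dd : d' <= d by rewrite ge_min lexx.
have := H s' t' (le_trans s1 dd) (le_trans t1 dd); rewrite mul1r => h.
have -> : Q s' t' - Q s t = (Q s' t' - Q s t - A * (s' - s) - B * (t' - t)) + (A *
    (s' - s) + B * (t' - t)) by ring.
have de : k * d' <= e.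
  have : d' <= e / k by rewrite ge_min lexx orbT.
  by rewrite ler_pdivlMr// mulrC.
apply: le_trans de; apply: le_trans (ler_normD _ _) _.
have h2 : `|A * (s' - s) + B * (t' - t)| <= `|A| * d' + `|B| * d'.
  by apply: le_trans (ler_normD _ _) _; rewrite !normrM lerD// ler_wpM2l.
have -> : k * d' = d' + d' + (`|A| * d' + `|B| * d') by rewrite /k; ring.
by apply: lerD h2; apply: le_trans h _; exact: lerD.
Qed.

Lemma leb2_shift (k : R * R -> \bar R) (a b : R) :
  measurable_fun setT k -> (forall p, 0 <= k p)%E ->
  (\int[@leb2 R]_p k (- a + p.1, - b + p.2)%R = \int[@leb2 R]_p k p)%E.
Proof.
move=> mk k0.
have mk' : measurable_fun setT (fun p : R * R => k (- a + p.1, - b + p.2)%R).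
  have m1 : measurable_fun setT (fst : R * R -> R) by exact: measurable_fst.
  have m2 : measurable_fun setT (snd : R * R -> R) by exact: measurable_snd.
  by apply: measurable_comp_pair => //; apply: measurable_funD.
rewrite /leb2 fubini_tonelli1// fubini_tonelli1// /fubini_F /=.
have mi : measurable_fun [set: R] (fun x : R => \int[mu]_y k (x, y))%E.
  exact: (@measurable_fun_fubini_tonelli_F _ _ (measurableTypeR R) (measurableTypeR
      R) R mu k).
transitivity (\int[mu]_x (fun x => \int[mu]_y k (x, y)) (- a + 1 * x)%R)%E.
  apply: eq_integral => x _ /=; rewrite mul1r.
  rewrite [RHS](@ge0_integral_affine R (fun y => k (- a + x, y)%R) (- b)%R 1)//
      ?oner_neq0//; last first.
    exact: measurable_comp_pair.
  by rewrite normr1 mul1e; apply: eq_integral => y _; rewrite mul1r.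
rewrite [RHS](@ge0_integral_affine R _ (- a)%R 1 _ mi) ?oner_neq0//; last first.
  by move=> x; exact: integral_ge0.
by rewrite normr1 mul1e.
Qed.

Lemma disc_toC (a : R[i]) r (p : R * R) : 0 < r ->
  disc a r (toC p) <-> disc0 r (- complex.Re a + p.1, - complex.Im a + p.2).
Proof.
move=> r0; case: a => a1 a2; rewrite /disc /disc0 /toC/=.
rewrite (addrC p.1) (addrC p.2) -[X in _ < X <-> _](gtr0_norm r0) -sqrtr_sqr.
by rewrite ltr_sqrt// exprn_gt0.
Qed.

Definition wdens (phi : R[i] -> R) (f : R[i] -> R[i]) (a : R[i]) (p : R * R) : R :=
  let z := (complex.Re a + p.1) +i* (complex.Im a + p.2) in
  (complex.Re (f z) ^+ 2 + complex.Im (f z) ^+ 2) * expR (- phi z).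

Lemma wdens_ge0 phi f a p : 0 <= wdens phi f a p.
Proof. by rewrite mulr_ge0 ?expR_ge0// addr_ge0// sqr_ge0. Qed.

Lemma wnorm2_disc0 phi f a r : 0 < r -> measurable_fun (disc0 r) (wdens phi f a) ->
  (wnorm2 phi (disc a r) f = \int[@leb2 R]_(p in disc0 r) (wdens phi f a p)%:E)%E.
Proof.
move=> r0 mN; rewrite /wnorm2.
have mD : measurable (disc0 r) by apply: open2_measurable; exact: open_disc0.
rewrite [RHS]integral_mkcond [LHS]integral_mkcond.
pose k : R * R -> \bar R := (EFin \o wdens phi f a) \_ (disc0 r).
have mN2 : measurable_fun (disc0 r) (EFin \o wdens phi f a) by apply/measurable_EFinP.
rewrite -[RHS]/(\int[@leb2 R]_p k p)%E -(@leb2_shift k (complex.Re a) (complex.Im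
    a)); last 2 first.
- exact: ((measurable_restrictT _ mD).1 mN2).
- by move=> p; apply: erestrict_ge0 => q _; rewrite lee_fin wdens_ge0.
apply: eq_integral => p _; rewrite /k !patchE.
have -> : ((- complex.Re a + p.1, - complex.Im a + p.2) \in disc0 r) = (p \in [set
    p | disc a r (toC p)]).
  by apply/idP/idP => /set_mem /= H; apply/mem_set/disc_toC.
by case: ifP => // _; rewrite /= /wdens/= !addNKr ?addrA ?subrr ?add0r.
Qed.

Definition weight_continuous (phi : R[i] -> R) (a : R[i]) r := forall p, disc0 r p ->
  {for (complex.Re a + p.1, complex.Im a + p.2), continuous (fun q : R * R => phi2
      phi q.1 q.2)}.

Lemma expR_weight_continuous phi a r : weight_continuous phi a r -> forall p, disc0
    r p ->
  {for p, continuous (fun p : R * R => expR (- phi ((complex.Re a + p.1) +i*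
      (complex.Im a + p.2))))}.
Proof.
move=> cp p pr.
apply: (@cvg_comp _ _ _ (fun p : R * R => - phi ((complex.Re a + p.1) +i*
    (complex.Im a + p.2))) expR); last exact: continuous_expR.
by apply: cvgN; apply: (@continuous_shift2 (fun q => phi2 phi q.1 q.2)); exact: cp.
Qed.

(** Makes the set of competitors nonempty. This matters because [inf] of the empty set is [0], which
    would defeat a positive lower bound for the index. *)
Lemma A2_cst phi a r M : 0 < r -> weight_continuous phi a r ->
  (forall p, disc0 r p -> expR (- phi ((complex.Re a + p.1) +i* (complex.Im a +
      p.2))) <= M) ->
  A2 (disc a r) phi (fun=> 1).
Proof.
move=> r0 cp bM; split; first by move=> z _; exact: derivable_cst.
have oD := @open_disc0 R r.
have mD : measurable (disc0 r) by exact: open2_measurable.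
have mw : measurable_fun (disc0 r) (wdens phi (fun=> 1) a).
  apply: open2_continuous_measurable => // p pr.
  by apply: cvgM; [exact: cvg_cst|exact: (expR_weight_continuous cp)].
rewrite wnorm2_disc0//.
apply: (@le_lt_trans _ _ (\int[@leb2 R]_(p in disc0 r) M%:E)%E).
  apply: ge0_le_integral => //.
  - by move=> p _; rewrite lee_fin wdens_ge0.
  - by apply/measurable_EFinP.
  - by move=> p pr; rewrite lee_fin /wdens/= expr1n expr0n/= addr0 mul1r; exact: bM.
rewrite integral_cst//.
have M0 : 0 <= M.
  by apply: le_trans (bM (0, 0) _); rewrite ?expR_ge0// /disc0/= expr0n/= addr0
      exprn_gt0.
apply: (@le_lt_trans _ _ (M%:E * @leb2 R (`[(- r)%R, r] `*` `[(- r)%R, r]))%E).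
  rewrite lee_wpmul2l ?lee_fin// le_measure ?inE//.
    by apply: measurableX.
  move=> [x y] /=; rewrite /disc0/= !in_itv/= -!ler_norml => xy.
  by split; rewrite -(ger0_norm (ltW r0)) -ler_sqr ?nnegrE// !real_normK
      ?num_real//; apply: ltW; apply: le_lt_trans xy; rewrite ?lerDl ?lerDr sqr_ge0.
have E : mu `[(- r)%R, r] = (r - - r)%:E.
  by rewrite [LHS]lebesgue_measure_itv/= lte_fin ifT ?EFinB// gtrN.
rewrite /leb2 product_measure1E//.
apply: (@le_lt_trans _ _ (M%:E * ((r - - r)%:E * (r - - r)%:E))%E); last by rewrite
    -!EFinM ltry.
by rewrite -E.
Qed.

Lemma CR_weight c1 c2 b1 b2 (x y : R) :
  CR (fun s t => pre (qre c1 c2 b1 b2 s t) (qim c1 c2 b1 b2 s t))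
     (fun s t => pim (qre c1 c2 b1 b2 s t) (qim c1 c2 b1 b2 s t)) x y.
Proof.
have Id := @CR_id R x y; have Cst k l := @CR_cst R k l x y.
have Z2 := CR_mul Id Id.
have H := CR_add (CR_mul (Cst c1 c2) Id) (CR_mul (Cst b1 b2) Z2).
have P := CR_add (CR_add (Cst 1 0) (CR_mul (Cst (- (1 / 2)) 0) H)) (CR_mul (Cst (1
    / 8) 0) (CR_mul H H)).
by move: P; congr CR; apply/funext => s; apply/funext => t; rewrite /pre /pim /qre
    /qim; field.
Qed.

Lemma CR_shift a b (U V : R -> R -> R) x y : CR U V (a + x) (b + y) ->
  CR (fun x y => U (a + x) (b + y)) (fun x y => V (a + x) (b + y)) x y.
Proof.
move=> H; have := @CR_affine R 1 a b U V x y; rewrite !mul1r => /(_ H).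
by congr CR; apply/funext => s; apply/funext => t; rewrite !mul1r.
Qed.

Lemma CR_continuous (U V : R -> R -> R) x y : CR U V x y ->
  {for (x, y), continuous (fun p : R * R => U p.1 p.2)} /\
  {for (x, y), continuous (fun p : R * R => V p.1 p.2)}.
Proof. by move=> [A [B [/cdiff_continuous ? /cdiff_continuous ?]]]. Qed.

Lemma wnorm2_lower phi f a r m (P1 P2 : R -> R -> R) :
  0 < r -> m * r ^+ 2 <= 1 -> holomorphic_on (disc a r) f -> f a = 1 ->
  weight_continuous phi a r ->
  (forall x y, CR P1 P2 x y) -> P1 0 0 = 1 -> P2 0 0 = 0 ->
  (forall s t, disc0 r (s, t) ->
    (P1 s t ^+ 2 + P2 s t ^+ 2) *
      expR (phi ((complex.Re a + s) +i* (complex.Im a + t)) - phi a) <=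
    1 + m * (s ^+ 2 + t ^+ 2)) ->
  ((expR (- phi a) * (pi * (r ^+ 2 - m * r ^+ 4 / 2)))%:E <= wnorm2 phi (disc a r) f)%E.
Proof.
move=> r0 mr hf fa cp crP P10 P20 PT.
pose U0 s t := complex.Re (f ((complex.Re a + s) +i* (complex.Im a + t))).
pose V0 s t := complex.Im (f ((complex.Re a + s) +i* (complex.Im a + t))).
have cr0 s t : disc0 r (s, t) -> CR U0 V0 s t.
  move=> st; apply: (@CR_shift _ _ (fun x y => complex.Re (f (x +i* y))) (fun x y
      => complex.Im (f (x +i* y)))).
  apply: derivable_CR; apply: hf.
  by apply: (disc_toC a (complex.Re a + s, complex.Im a + t) r0).2; rewrite /= !addKr.
have cN p : disc0 r p -> {for p, continuous (wdens phi f a)}.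
  move=> pr; have [cU cV] : {for p, continuous (fun p : R * R => U0 p.1 p.2)} /\
     {for p, continuous (fun p : R * R => V0 p.1 p.2)}.
    by case: p pr => s t /cr0/CR_continuous.
  apply: cvgM; last exact: (expR_weight_continuous cp).
  apply: cvgD.
  - by apply: (@cvg_comp _ _ _ (fun p : R * R => U0 p.1 p.2) (fun x : R => x ^+
      2)); [exact: cU|exact: exprn_continuous].
  - by apply: (@cvg_comp _ _ _ (fun p : R * R => V0 p.1 p.2) (fun x : R => x ^+
      2)); [exact: cV|exact: exprn_continuous].
rewrite wnorm2_disc0//; last first.
  by apply: open2_continuous_measurable => //; exact: open_disc0.
have aE : (complex.Re a + 0) +i* (complex.Im a + 0) = a by case: (a) => u v /=;
    rewrite !addr0.
(* The two functions supplied are the real and imaginary parts of [f * (P1 + i P2)]. *)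
apply: (@disc0_lower_bound R (wdens phi f a) (fun s t => U0 s t * P1 s t - V0 s t *
    P2 s t)
  (fun s t => U0 s t * P2 s t + V0 s t * P1 s t) r m (expR (- phi a))).
- exact: r0.
- exact: mr.
- exact: expR_ge0.
- exact: cN.
- by move=> p; exact: wdens_ge0.
- by move=> x y xy; apply: CR_mul; [exact: cr0|exact: crP].
- by rewrite P10 P20 /U0 aE fa/= mulr0 subr0 mulr1.
move=> x y xy; rewrite /wdens/=.
set z := _ +i* _.
have -> : expR (- phi z) = expR (- phi a) * expR (- (phi z - phi a)).
  by rewrite -expRD; congr expR; ring.
rewrite mulrCA ler_pM2l ?expR_gt0//.
rewrite -addrA -opprD; apply: complex_am_gm; first exact: expR_gt0.
by rewrite -expRN opprK; exact: PT.
Qed.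

Lemma L2index_lower phi a r m (P1 P2 : R -> R -> R) M :
  0 < r -> m * r ^+ 2 <= 1 -> weight_continuous phi a r ->
  (forall x y, CR P1 P2 x y) -> P1 0 0 = 1 -> P2 0 0 = 0 ->
  (forall s t, disc0 r (s, t) ->
    (P1 s t ^+ 2 + P2 s t ^+ 2) *
      expR (phi ((complex.Re a + s) +i* (complex.Im a + t)) - phi a) <=
    1 + m * (s ^+ 2 + t ^+ 2)) ->
  (forall p, disc0 r p -> expR (- phi ((complex.Re a + p.1) +i* (complex.Im a +
      p.2))) <= M) ->
  1 - m * r ^+ 2 / 2 <= L2index phi a r.
Proof.
move=> r0 mr cp crP P10 P20 PT bM; apply: lb_le_inf.
  eexists; exists (fun=> 1); split; [exact: A2_cst bM|by []|reflexivity].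
move=> _ [f [[hf fin] fa ->]].
have pi0 := @pi_gt0 R; have E0 := @expR_gt0 R (- phi a).
have d0 : 0 < pi * r ^+ 2 * expR (- phi a) by rewrite !mulr_gt0// exprn_gt0.
rewrite ler_pdivlMr//.
have := wnorm2_lower r0 mr hf fa cp crP P10 P20 PT.
(* Membership in [A2] makes the norm finite, so [fine] returns its true value. *)
rewrite -[wnorm2 _ _ _]fineK; last first.
  rewrite ge0_fin_numE//; apply: integral_ge0 => p _.
  by rewrite lee_fin mulr_ge0 ?expR_ge0// addr_ge0// sqr_ge0.
rewrite lee_fin; apply: le_trans.
by rewrite le_eqVlt; apply/orP; left; apply/eqP; field.
Qed.

End L2index.

(** * Small radii: asymptotic lower bound and comparison *)

Lemma disc0_box (R : realType) (r d : R) (p : R * R) : 0 < r -> r <= d -> disc0 r p ->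
  `|p.1| <= d /\ `|p.2| <= d.
Proof.
move=> r0 rd; rewrite /disc0/= => pr.
split; apply: le_trans rd; rewrite -(ger0_norm (ltW r0)) -ler_sqr ?nnegrE//
    !real_normK ?num_real//;
  by apply: ltW; apply: le_lt_trans pr; rewrite ?lerDl ?lerDr sqr_ge0.
Qed.

(** The trace-free part of the Hessian is the real part of [b z^2] with [b = (A - C)/4 - i B/2];
    what is left of the quadratic form is [(A + C)/4] times [|z|^2]. *)
Lemma harmonic_part (R : realType) (f f0 s t p q A B C e : R) :
  f - f0 - p * s - q * t - A * (s ^+ 2 / 2) - B * (s * t) - C * (t ^+ 2 / 2) <=
    e * (s ^+ 2 + t ^+ 2) ->
  f - f0 <= qre p (- q) ((A - C) / 4) (- (B / 2)) s t
            + (4^-1 * (A + C) + e) * (s ^+ 2 + t ^+ 2).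
Proof. by rewrite /qre; lra. Qed.

Lemma L2index_asymptotics (R : realType) (Omega : set R[i]) (phi : R[i] -> R) (a :
    R[i]) (r1 e : R) :
  0 < r1 -> disc a r1 `<=` Omega -> smooth_on Omega phi -> 0 < e ->
  exists2 d, 0 < d & forall r, 0 < r -> r <= d ->
    1 - (ddbar phi a + 3 * e) * r ^+ 2 / 2 <= L2index phi a r.
Proof.
move=> r10 sub sm e0.
pose F := phi2 phi; pose O := [set p : R * R | Omega (toC p)].
pose a1 := complex.Re a; pose a2 := complex.Im a.
(* The square of half side [r0] fits in the disc, as [2 * r0 ^+ 2 = r1 ^+ 2 / 2]. *)
pose r0 := r1 / 2; have r00 : 0 < r0 by rewrite divr_gt0.
have inO s t : `|s| <= r0 -> `|t| <= r0 -> O (a1 + s, a2 + t).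
  move=> sr tr; apply: sub; apply: (disc_toC a _ r10).2; rewrite /= !addKr /disc0/=.
  have h (w : R) : `|w| <= r0 -> w ^+ 2 <= r0 ^+ 2.
    by move=> wr; rewrite -(real_normK (num_real w)) lerXn2r// nnegrE// ltW.
  apply: (le_lt_trans (lerD (h _ sr) (h _ tr))); rewrite /r0.
  have : 0 < r1 ^+ 2 by rewrite exprn_gt0.
  by rewrite expr_div_n; move: (r1 ^+ 2) => w; lra.
have [dT dT0 HT] := @taylor2 R F O a1 a2 r0 r00 inO (sm 2%N) e e0.
pose c1 := dx F a1 a2; pose c2 := - dy F a1 a2.
pose b1 := (dx (dx F) a1 a2 - dy (dy F) a1 a2) / 4; pose b2 := - (dx (dy F) a1 a2 / 2).
pose lam := ddbar phi a.
have [dW dW0 HW] := @weight_bound R c1 c2 b1 b2 lam e e0.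
have cF p : O p -> {for p, continuous (fun q : R * R => F q.1 q.2)} by exact: (sm 0%N).
have Oa : O (a1, a2) by have := inO 0 0; rewrite normr0 !addr0 => /(_ (ltW r00)
    (ltW r00)).
have [dC dC0 HC] : exists2 d, 0 < d & forall s t, `|s| <= d -> `|t| <= d ->
   `|F (a1 + s) (a2 + t) - F a1 a2| <= 1.
  have := cF _ Oa => /cvgrPdistC_le/(_ _ ltr01)/nbhs_ballP[d /= d0 H].
  exists (d / 2); first by rewrite divr_gt0.
  move=> s t sd td; apply: (H (a1 + s, a2 + t)).
  by split; rewrite /ball/= opprD addrA subrr sub0r normrN; lra.
pose m := lam + 3 * e.
(* The first two bounds give [m * r ^+ 2 <= 1]; [dC] keeps the weight within [1] of its central
   value, whence the bound [expR (1 - phi a)] below. *)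
pose d := Num.min (Num.min 1 (1 / (`|m| + 1))) (Num.min (Num.min r0 dT) (Num.min dW
    dC)).
have m1 : 0 < `|m| + 1 by rewrite ltr_wpDl.
exists d; first by rewrite !lt_min r00 dT0 dW0 dC0 ltr01 divr_gt0.
move=> r rp; rewrite !le_min => /andP[/andP[rd1 rdm] /andP[/andP[rd0 rdT] /andP[rdW
    rdC]]].
have aE : (a1 +i* a2)%C = a by rewrite /a1 /a2; case: (a).
have Fa : F a1 a2 = phi a by rewrite /F /phi2 aE.
have q0 : qre c1 c2 b1 b2 0 0 = 0 by rewrite /qre; ring.
have i0 : qim c1 c2 b1 b2 0 0 = 0 by rewrite /qim; ring.
pose P1 s t := pre (qre c1 c2 b1 b2 s t) (qim c1 c2 b1 b2 s t).
pose P2 s t := pim (qre c1 c2 b1 b2 s t) (qim c1 c2 b1 b2 s t).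
apply: (@L2index_lower R phi a r m P1 P2 (expR (1 - phi a))) => //.
- apply: (@le_trans _ _ (`|m| * r)).
    apply: (@le_trans _ _ (`|m| * r ^+ 2)).
      by rewrite ler_wpM2r ?sqr_ge0// ler_norm.
    by rewrite ler_wpM2l// expr2 ler_piMr// ltW.
  by move: rdm; rewrite ler_pdivlMr//; lra.
- move=> p pr; have [p1 p2] := disc0_box rp rd0 pr.
  by apply: cF; exact: inO.
- by move=> x y; exact: CR_weight.
- by rewrite /P1 q0 i0 /pre; field.
- by rewrite /P2 q0 i0 /pim; field.
- move=> s t st.
  have [/= sT tT] := disc0_box rp rdT st; have [/= sW tW] := disc0_box rp rdW st.
  apply: le_trans (HW s t sW tW); rewrite ler_wpM2l ?addr_ge0 ?sqr_ge0// ler_expR.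
  have := HT s t sT tT; rewrite Fa => /(le_trans (ler_norm _)).
  exact: harmonic_part.
- move=> p pr; have [p1 p2] := disc0_box rp rdC pr.
  rewrite ler_expR; have := HC _ _ p1 p2; rewrite Fa ler_norml => /andP[+ _].
  by rewrite /F /phi2 /a1 /a2; move: (phi _) (phi a) => u v; lra.
Qed.

Theorem theorem1p3 (R : realType) (Omega : set R[i]) (phi : R[i] -> R)
    (gamma : R[i] -> R) (g : R[i] -> R -> R) :
  domain Omega -> bounded_set Omega -> smooth_on Omega phi ->
  (forall a, Omega a ->
     [/\ 0 < gamma a, gamma a < delta Omega a,
         lsc_on `[0, gamma a] (g a),
         (forall r, 0 <= r <= gamma a -> 0 <= g a r) &
         (forall r, 0 < r < gamma a -> L2index phi a r <= expR (- (g a r * r ^+ 2)))]) ->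
  forall a, Omega a -> ddbar phi a >= 2 * g a 0.
Proof.
move=> _ _ sm H a Oa; have [ga0 gd lsc g0 L] := H a Oa.
(* Without such a radius [delta] would be [sup] of the empty set, that is [0], against
   [0 < gamma a < delta Omega a]. *)
have [r1 [r10 sub]] : [set r : R | 0 < r /\ disc a r `<=` Omega] !=set0.
  apply/set0P/negP => /eqP E; move: (lt_trans ga0 gd).
  by rewrite /delta E sup0 ltxx.
(* Seven is [3 + 2 * 2]: three from the asymptotics of the index, and one each from semi-continuity
   and from linearizing the exponential, both doubled when the factor [1 / 2] is cleared. *)
apply/ler_addgt0Pr => e' e'0; pose e := e' / 7; have e0 : 0 < e by rewrite divr_gt0.
have [d1 d10 H1] := L2index_asymptotics r10 sub sm e0.
have I0 : `[0, gamma a]%classic (0 : R) by rewrite /= in_itv/= lexx ltW.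
have /nbhs_ballP[d2 /= d20 H2] := lsc 0 I0 e e0.
pose k := `|g a 0 - e| + 1; have k0 : 0 < k by rewrite ltr_wpDl.
have ek0 : 0 < e / k by rewrite divr_gt0.
have [d3 d30 H3] := expR_second_order ek0.
(* For each [e] one small radius suffices. The halves turn the strict conditions [r < gamma a] and
   [r < d2] into bounds by a minimum, and [d3 / k] keeps the exponent within reach of the
   expansion. *)
pose r := Num.min (Num.min 1 (gamma a / 2)) (Num.min (Num.min d1 (d2 / 2)) (d3 / k)).
have r0 : 0 < r by rewrite !lt_min ltr01 d10 !divr_gt0.
have [rr1 rg rd1 rd2 rd3] : [/\ r <= 1, r <= gamma a / 2, r <= d1, r <= d2 / 2 & r
    <= d3 / k].
  by split; rewrite !ge_min lexx ?orbT.
have rga : r < gamma a by lra.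
have := H2 r; rewrite /ball/= sub0r normrN (gtr0_norm r0) => /(_ _ _)H2r.
have {}H2r : g a 0 - e < g a r.
  by apply: H2r; [lra|rewrite in_itv/= (ltW r0) (ltW rga)].
have A1 := H1 r r0 rd1.
have A2 := L r _; rewrite r0 rga in A2; have {}A2 := A2 isT.
have r20 : 0 < r ^+ 2 by rewrite exprn_gt0.
have A3 : expR (- (g a r * r ^+ 2)) <= expR (- ((g a 0 - e) * r ^+ 2)).
  by rewrite ler_expR lerN2 ler_pM2r// ltW.
have yk : `|- ((g a 0 - e) * r ^+ 2)| <= k * r ^+ 2.
  by rewrite normrN normrM (gtr0_norm r20) ler_pM2r// lerDl.
have yd : k * r ^+ 2 <= d3.
  rewrite mulrC -ler_pdivlMr//; apply: le_trans rd3.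
  by rewrite expr2 ler_piMr// ltW.
have [A4 _] := H3 _ (le_trans yk yd).
have A5 : e / k * `|- ((g a 0 - e) * r ^+ 2)| <= e * r ^+ 2.
  apply: (@le_trans _ _ (e / k * (k * r ^+ 2))); first by rewrite ler_pM2l.
  by rewrite mulrA divfK ?gt_eqF.
have A6 := le_trans (ler_norm _) (le_trans A4 A5).
have A7 : 1 - (ddbar phi a + 3 * e) * r ^+ 2 / 2 <= 1 - (g a 0 - e) * r ^+ 2 + e *
    r ^+ 2.
  apply: le_trans A1 _; apply: le_trans A2 _; apply: le_trans A3 _.
  by move: A6; move: (expR _) => w; lra.
have A8 : (2 * g a 0 - 7 * e) * r ^+ 2 <= ddbar phi a * r ^+ 2.
  by move: A7; move: (ddbar phi a) (g a 0) (r ^+ 2) => u v w; lra.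
move: A8; rewrite ler_pM2r// /e; move: (ddbar phi a) (g a 0) => u v; lra.
Qed.
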